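(* Let $C_0=24e^2$. Let $A\in\{-1,1\}^{M\times N}$ be a total sign matrix with $N\geq 2$ columns and $\operatorname{VC}(A)=d\geq 1$. Then $$\operatorname{ind}|S(A)|\leq C_0\,d\,\log(2eN/d)\,\log(2N)=O(d\log^2 N),$$ irrespective of the number $M$ of rows (the implied constant in the $O$ is absolute).
   Context: All logarithms are natural, and $\log^2(x)=(\log x)^2$. A total sign matrix is a matrix with entries in $\{-1,1\}$. The VC dimension $\operatorname{VC}(A)$ of $A$ is the largest $d$ such that some $d$ columns of $A$ carry every pattern in $\{-1,1\}^d$ among the rows of $A$ restricted to these $d$ columns. With columns indexed by $[N]=\{1,\dots,N\}$, the sign complex $S(A)$ is the simplicial complex generated by the following simplices on the signed column set $\{1^+,1^-,\dots,N^+,N^-\}$: $$\sigma_r^+=\{i^+:r_i=+1\}\cup\{i^-:r_i=-1\},\qquad \sigma_r^-=-\sigma_r^+,$$ as $r$ ranges over the rows of $A$, where $-$ exchanges $i^+$ and $i^-$ for every $i$. Exchanging $i^+$ and $i^-$ defines a free simplicial involution on $S(A)$, and $|S(A)|$ denotes the geometric realization with the induced free involution. A continuous map between spaces with free (fixed-point-free) involutions is equivariant if it commutes with the involutions; spheres carry the antipodal involution. For a space $X$ with a free involution, $\operatorname{ind}X=\min\{k\geq0:\text{there is an equivariant map }X\to S^k\}$, with value $+\infty$ if no such map exists, and $\operatorname{ind}\varnothing=-1$. *)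

(* Defs.v *)
From HB Require Import structures.
From mathcomp Require Import all_boot all_order all_algebra.
From mathcomp Require Import all_classical all_reals all_analysis.

Set Implicit Arguments.
Unset Strict Implicit.
Unset Printing Implicit Defensive.

Import Order.TTheory GRing.Theory Num.Theory.
Import numFieldNormedType.Exports.

Local Open Scope classical_set_scope.
Local Open Scope ring_scope.

Definition total_sign (M N : nat) (A : 'M[int]_(M, N)) : Prop :=
  forall r i, A r i = 1 \/ A r i = -1.

(* The pattern [p] encodes the sign vector with entries [(-1) ^+ p i];
   only its values on [B] matter. *)
Definition shattered (M N : nat) (A : 'M[int]_(M, N)) (B : {set 'I_N}) : bool :=
  [forall p : {ffun 'I_N -> bool},
     [exists r, [forall i in B, A r i == (-1) ^+ p i]]].

Definition VCdim (M N : nat) (A : 'M[int]_(M, N)) : nat :=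
  (\max_(B : {set 'I_N} | shattered A B) #|B|)%N.

Section Realization.
Variables (R : realType) (V : finType).

Definition generated_complex (F : {set {set V}}) : {set {set V}} :=
  [set s : {set V} | [exists f in F, s \subset f]]%SET.

Definition barycentric (x : 'rV[R]_#|V|) (v : V) : R := x ord0 (enum_rank v).

(* The vertex set is finite, so the topology of [R ^ #|V|] induces the usual
   topology of |K|. The empty set is never the support of a point, so it does
   not matter whether it is counted as a simplex. *)
Definition realization (K : {set {set V}}) : set 'rV[R]_#|V| :=
  [set x | [/\ forall v, 0 <= barycentric x v,
               \sum_v barycentric x v = 1 &
               [set v | barycentric x v != 0]%SET \in K]].

(* The affine extension of an involution [nu] of the vertices: the coordinate
   of the image at [v] is the coordinate of [x] at [nu^-1 v = nu v]. *)
Definition induced_involution (nu : V -> V) (x : 'rV[R]_#|V|) : 'rV[R]_#|V| :=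
  \row_i barycentric x (nu (enum_val i)).

End Realization.

Definition sphere (R : realType) (k : nat) : set 'rV[R]_k.+1 :=
  [set y | \sum_i y ord0 i ^+ 2 = 1].
Arguments sphere : clear implicits.

Section Index.
Variables (R : realType) (T : topologicalType).

Definition free_involution (X : set T) (nu : T -> T) : Prop :=
  [/\ forall x, X x -> X (nu x),
      {within X, continuous nu},
      forall x, X x -> nu (nu x) = x &
      forall x, X x -> nu x <> x].

Definition has_equivariant_map (X : set T) (nu : T -> T) (k : nat) : Prop :=
  exists f : T -> 'rV[R]_k.+1,
    [/\ {within X, continuous f},
        forall x, X x -> sphere R k (f x) &
        forall x, X x -> f (nu x) = - f x].

(* Meaningful when [free_involution X nu] holds; for the realization of a sign
   complex this is [sign_involution_free] below. *)
Definition ind (X : set T) (nu : T -> T) : \bar R :=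
  if `[< X = set0 >] then (-1)%:E
  else match pselect (exists k, `[< has_equivariant_map X nu k >]) with
       | left exk => (ex_minn exk)%:R%:E
       | right _ => +oo%E
       end.

End Index.

Section SignComplex.

(* The signed column i^+ is [(i, true)] and i^- is [(i, false)]. *)
Definition flip_sign (N : nat) (v : 'I_N * bool) : 'I_N * bool :=
  (v.1, ~~ v.2).

Variables (M N : nat) (A : 'M[int]_(M, N)).

Definition sigma_plus (r : 'I_M) : {set 'I_N * bool} :=
  [set v : 'I_N * bool | A r v.1 == if v.2 then 1 else -1]%SET.

Definition sigma_minus (r : 'I_M) : {set 'I_N * bool} :=
  (@flip_sign N @: sigma_plus r)%SET.

Definition sign_complex : {set {set 'I_N * bool}} :=
  generated_complex ([set sigma_plus r | r : 'I_M] :|: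
                     [set sigma_minus r | r : 'I_M])%SET.

End SignComplex.

Definition sign_realization (R : realType) (M N : nat) (A : 'M[int]_(M, N)) :
    set 'rV[R]_#|{: 'I_N * bool}| :=
  realization (sign_complex A).

Definition sign_involution (R : realType) (N : nat) :
    'rV[R]_#|{: 'I_N * bool}| -> 'rV[R]_#|{: 'I_N * bool}| :=
  induced_involution (@flip_sign N).
Arguments sign_involution : clear implicits.

Definition C0 (R : realType) : R := 24 * expR 1 ^+ 2.
Arguments C0 : clear implicits.

Lemma flip_signK (N : nat) : involutive (@flip_sign N).
Proof. by case=> i b; rewrite /flip_sign /= negbK. Qed.

Lemma sign_complex_flip (M N : nat) (A : 'M[int]_(M, N)) s :
  s \in sign_complex A -> (@flip_sign N @: s)%SET \in sign_complex A.
Proof.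
have flipK (t : {set 'I_N * bool}) :
    (@flip_sign N @: (@flip_sign N @: t) = t)%SET.
  by rewrite -imset_comp -[RHS]imset_id; apply: eq_imset => v /=; exact: flip_signK.
rewrite !inE => /existsP[f /andP[]]; rewrite inE => /orP[] /imsetP[r _ ->] sf;
  apply/existsP.
- exists (sigma_minus A r); rewrite inE (imset_f (sigma_minus A)) ?orbT //=.
  exact: imsetS.
- exists (sigma_plus A r); rewrite inE (imset_f (sigma_plus A)) //=.
  by rewrite -(flipK (sigma_plus A r)); exact: imsetS.
Qed.

Lemma sign_complex_antipode_free (M N : nat) (A : 'M[int]_(M, N)) s v :
  s \in sign_complex A -> v \in s -> flip_sign v \notin s.
Proof.
have main r (w : 'I_N * bool) :
    w \in sigma_plus A r -> flip_sign w \notin sigma_plus A r.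
  by case: w => i []; rewrite !inE /= => /eqP ->.
rewrite inE => /existsP[f /andP[]]; rewrite inE => /orP[] /imsetP[r _ ->]
  /fintype.subsetP sf vs; apply/negP => /sf.
- by apply/negP/main/sf.
- move=> /imsetP[w wr /(can_inj (@flip_signK N)) ?]; subst w.
  have /imsetP[w wr' vw] := sf _ vs.
  by move: (main _ _ wr'); rewrite -vw wr.
Qed.

Lemma barycentric_induced (R : realType) (V : finType) (nu : V -> V)
    (x : 'rV[R]_#|V|) (v : V) :
  barycentric (induced_involution nu x) v = barycentric x (nu v).
Proof. by rewrite /barycentric mxE enum_rankK. Qed.

Lemma induced_involution_continuous (R : realType) (V : finType) (nu : V -> V) :
  continuous (@induced_involution R V nu).
Proof.
move=> x A [P xP PA].
have nb i : nbhs x [set y : 'rV[R]_#|V| |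
    P ord0 i (y ord0 (enum_rank (nu (enum_val i))))].
  apply: (@coord_continuous R 1 #|V| ord0 (enum_rank (nu (enum_val i))) x).
  by have := xP ord0 i; rewrite mxE.
have := @filter_forall _ _ _ _ (nbhs_filter x) nb.
apply: (@filterS _ _ (nbhs_filter x)) => y yP; apply: PA => j i.
by rewrite (ord1 j) mxE; exact: yP.
Qed.

Lemma sign_involution_free (R : realType) (M N : nat) (A : 'M[int]_(M, N)) :
  free_involution (@sign_realization R M N A) (sign_involution R N).
Proof.
have invK (x : 'rV[R]_#|{: 'I_N * bool}|) :
    sign_involution R N (sign_involution R N x) = x.
  apply/rowP => i; rewrite -(enum_valK i).
  by rewrite -!/(barycentric _ _) !barycentric_induced flip_signK.
split.
- move=> x [x0 x1 xK]; split=> [v||].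
  + by rewrite barycentric_induced; exact: x0.
  + rewrite -x1 (reindex_inj (can_inj (@flip_signK N))) /=.
    by apply: eq_bigr => v _; rewrite barycentric_induced flip_signK.
  + have -> : [set v | barycentric (sign_involution R N x) v != 0]%SET =
        (@flip_sign N @: [set v | barycentric x v != 0])%SET.
      rewrite (can_imset_pre _ (@flip_signK N)); apply/setP => v.
      by rewrite !inE barycentric_induced.
    exact: sign_complex_flip.
- by apply: continuous_subspaceT; exact: induced_involution_continuous.
- by move=> x _; exact: invK.
- move=> x [x0 x1 xK] fixx.
  have [v xv] : exists v, barycentric x v != 0.
    apply/not_existsP => xv0; move: x1; rewrite big1 => [|v _].
      by move/eqP; rewrite eq_sym oner_eq0.
    by apply/eqP; apply: contrapT => /negP; exact: xv0.
  have vs : v \in [set v | barycentric x v != 0]%SET by rewrite inE.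
  have := sign_complex_antipode_free xK vs.
  rewrite inE negbK => /eqP xf0; move: xv.
  by rewrite -fixx barycentric_induced xf0 eqxx.
Qed.

(* Main.v *)
Require Import Defs.
From HB Require Import structures.
From mathcomp Require Import all_boot all_order all_algebra.
From mathcomp Require Import all_classical all_reals all_analysis.
From mathcomp Require Import ring lra.
Import Order.TTheory GRing.Theory Num.Theory.
Import numFieldNormedType.Exports.
Local Open Scope ring_scope.

Set Implicit Arguments.
Unset Strict Implicit.
Unset Printing Implicit Defensive.

(** Let [I] be the set of the distinct rows of the matrix, [J] its columns and
    [B] its sign entries. A point of the sign complex gives a signed vector [xi]
    on [J] with sum of absolute values at most 1, and the pairings [u] of [xi]
    with the rows; the map to [u] is odd. Since the point lies in a simplex of
    some row, the largest [`|u i|] is 1, so that [u] is not zero.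

    The vector [u] lives in a space of dimension [#|I|], and the idea is to lower
    this dimension to about [ln #|I| * ln #|J|] by a dynamical system.
    Let [T u j] be the sum over [i] of [B j i * u i ^ (2k + 1)], let [T'] be the
    same map from [J] to [I] with exponent [2k' + 1], and iterate the full step
    [T' T]: this is the power method for the norm of [B] between two spaces with
    even exponents [2k + 2] and [2k' + 2]. All these maps are odd polynomial maps.
    By Hoelder's inequality the norm of [T u] for a normalized [u] cannot decrease
    along the iteration ([good_next]), and it is at least one at the start
    ([good_initial]), so that no image ever becomes small.

    Up to positive scalars, the full step contracts volumes of dimension [K] if
    [K] exceeds a constant times [(2k + 1) (2k' + 1)]. Indeed, measure a
    displacement [du] at [u] with the weights [`|u i| ^ k]. At vectors of norm
    one, the derivative of [T] is then the matrix with entries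
    [(2k + 1) * `|y j| ^ k' * B j i * `|u i| ^ k], and the square of its
    Hilbert-Schmidt norm is [(2k + 1) ^ 2] times the product of the sum of the
    [`|u i| ^ 2k] and the sum of the [`|y j| ^ 2k']. If [k + 1 >= ln #|I|] and
    [k' + 1 >= ln #|J|], each sum is at most about [e] ([power_mean]). An
    ellipsoid with small Hilbert-Schmidt norm is covered by few balls
    ([ellipsoid_cover]). So a half step replaces a cell, that is a ball in
    these weights, by [exp (3 K / 5)] cells of comparable radius ([half_step]),
    and after [m] full steps the number of cells times the [K]-th power of
    their radius is as small as desired ([covered_iter], [odd_power_map]). A
    random linear map to a space of dimension [K], applied to the odd powers of
    the coordinates, then has no zero in any of the cells
    ([nonvanishing_map]). The composite is an odd map without zeros from the
    complex to a space of dimension [K], and the index is at most [K - 1].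

    By the Sauer-Shelah lemma ([card_shattered_le]), [ln #|I|] is at most
    [d * ln (e N / d)]. Taking [k] and [k'] to be the integral parts of [ln #|I|]
    and [ln N], the condition [6 e^2 (2k + 1) (2k' + 1) <= K] holds for every [K]
    above [24 e^2 d ln (2 e N / d) ln (2 N)]. *)

(** * Power means and elementary inequalities *)

(** [lra] on the hypotheses in front of the goal: it is slow in the long contexts
    below. *)
Ltac goal_lra :=
  repeat match goal with H : is_true _ |- _ => clear H end;
  repeat match goal with x := _ |- _ => clearbody x end;
  repeat match goal with H : forall _, _ |- _ => clear H end;
  intros; lra.

Lemma subX_le (R : realType) (L a b : R) (k : nat) :
  `|a| <= L -> `|b| <= L -> `|a ^+ k.+1 - b ^+ k.+1| <= k.+1%:R * L ^+ k * `|a - b|.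
Proof.
move=> aL bL; rewrite subrXX normrM [leRHS]mulrC ler_wpM2l//.
apply: le_trans (ler_norm_sum _ _ _) _.
apply: le_trans (_ : \sum_(i < k.+1) L ^+ k <= _).
  apply: ler_sum => i _; rewrite normrM !normrX.
  have ik : (i <= k)%N by rewrite -ltnS.
  rewrite -[X in L ^+ X](subnK ik) exprD.
  by apply: ler_pM; rewrite ?exprn_ge0// lerXn2r// ?nnegrE ?normr_ge0// (le_trans _ aL).
by rewrite sumr_const card_ord mulr_natl.
Qed.

(** The weighted arithmetic-geometric mean inequality with weights [k : 1], free
    of roots; the power mean and Hoelder inequalities below come from it. *)
Lemma wAGM (R : realType) (s t : R) (k : nat) : 0 <= s -> 0 <= t ->
  k.+1%:R * (s ^+ k * t) <= k%:R * s ^+ k.+1 + t ^+ k.+1.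
Proof.
move=> s0 t0; elim: k => [|k IH]; first by rewrite !expr0 !mul1r mul0r add0r expr1.
have sk0 : 0 <= s ^+ k by rewrite exprn_ge0.
have H1 := ler_wpM2r t0 IH.
have H2 : 0 <= k.+1%:R * (s ^+ k * (s - t) ^+ 2).
  by apply: mulr_ge0 => //; apply: mulr_ge0 => //; exact: sqr_ge0.
rewrite [s ^+ k.+2]exprS [t ^+ k.+2]exprS.
move: H1 H2; rewrite -(natr1 k.+1) -(natr1 k) (exprS s k).
set K : R := k%:R; set x := s ^+ k; set y := t ^+ k.+1 => H1 H2.
lra.
Qed.

Lemma exists_root (R : realType) (x : R) (k : nat) :
  0 < x -> exists2 l : R, 0 < l & l ^+ k.+1 = x.
Proof.
move=> x0; exists (x `^ (k.+1%:R^-1)); first exact: powR_gt0.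
by rewrite -powR_mulrn ?powR_ge0// -powRrM mulVf ?pnatr_eq0// powRr1// ltW.
Qed.

Lemma expr_ge_base (R : realType) (x t : R) (k : nat) :
  0 <= x -> t <= 1 -> t <= x ^+ k.+1 -> t <= x.
Proof.
move=> x0 t1 tx; rewrite leNgt; apply/negP => xt.
have : x ^+ k.+1 <= x by rewrite -[leRHS]expr1 ler_wiXn2l// ltW// (lt_le_trans xt).
by move=> h; have := lt_le_trans xt (le_trans tx h); rewrite ltxx.
Qed.

Lemma bernoulli (R : realType) (x : R) (k : nat) :
  0 <= x <= 1 -> 1 - k%:R * x <= (1 - x) ^+ k.
Proof.
move=> /andP[x0 x1]; elim: k => [|k IH]; first by rewrite expr0 mul0r subr0.
rewrite exprS; have h : 0 <= 1 - x by rewrite subr_ge0.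
apply: le_trans (ler_wpM2l h IH).
rewrite -natr1; have : 0 <= k%:R * x ^+ 2 by apply: mulr_ge0 => //; exact: sqr_ge0.
set K : R := k%:R; nra.
Qed.

(** * Discrete Gaussian weights *)

Lemma sinh_ge (R : realType) (x : R) : 0 <= x -> 2 * x <= expR x - expR (- x).
Proof.
move=> x0.
have df (y : R) : is_derive y 1 (expR \- (fun z => expR (- z)) \- (fun z => 2 * z))
    (expR y + expR (- y) - 2).
  apply: is_derive_eq; rewrite -?[_ *: _]/(_ * _) ?mulrN1 ?opprK ?mulr1//.
have dr (y : R) : derivable (expR \- (fun z : R => expR (- z)) \- (fun z : R => 2 * z)) y 1.
  by have [] := df y.
suff : (expR \- (fun z => expR (- z)) \- (fun z => 2 * z)) 0 <=
       (expR \- (fun z : R => expR (- z)) \- (fun z => 2 * z)) x.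
  by rewrite /= oppr0 mulr0 subr0 subrr subr_ge0.
apply: (@ger0_derive1_ndecry R _ 0) => //.
- move=> y _; rewrite derive1E derive_val.
  have := expR_ge1Dx y; have := expR_ge1Dx (- y); lra.
- by apply: derivable_within_continuous => y _.
Qed.

Definition gauss (R : realType) (rho x : R) : R := expR (- (rho * x ^+ 2)).

(** For [k < 2 L + 1] these are the integers of [-L, L]. *)
Definition centered (R : realType) (L k : nat) : R := k%:R - L%:R.

Definition gauss_mass (R : realType) (rho : R) (L : nat) : R :=
  \sum_(k < L.*2.+1) gauss rho (centered R L k).

Lemma gauss_gt0 (R : realType) (rho x : R) : 0 < gauss rho x.
Proof. exact: expR_gt0. Qed.

Lemma gauss_mass_gt0 (R : realType) (rho : R) L : 0 < gauss_mass rho L.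
Proof.
rewrite /gauss_mass (bigD1 ord0)//= ltr_wpDr// ?gauss_gt0//.
by apply: sumr_ge0 => i _; rewrite ltW// gauss_gt0.
Qed.

(** Completing the square turns the difference into [gauss rho x] times
    a hyperbolic sine, and [sinh y >= y]. *)
Lemma gauss_difference (R : realType) (rho x : R) : 0 < rho ->
  4 * rho * expR (- rho) * (x ^+ 2 * gauss rho x) <=
  x * (gauss rho (x - 1) - gauss rho (x + 1)).
Proof.
move=> r0.
have E (e : R) : e ^+ 2 = 1 ->
    gauss rho (x - e) = expR (- rho) * (gauss rho x * expR (2 * rho * x * e)).
  by move=> e2; rewrite /gauss -!expRD; congr expR; rewrite sqrrB e2; ring.
have -> : x + 1 = x - (-1) by rewrite opprK.
rewrite (E 1) ?expr1n// (E (-1)) ?sqrrN ?expr1n// mulr1 mulrN1.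
suff H : 4 * rho * x ^+ 2 <= x * (expR (2 * rho * x) - expR (- (2 * rho * x))).
  have g0 : 0 <= expR (- rho) * gauss rho x.
    by rewrite mulr_ge0 ?expR_ge0// ltW// gauss_gt0.
  have := ler_wpM2r g0 H.
  set a := expR (- rho); set b := gauss rho x; set c := expR _; set d := expR _.
  lra.
have [x0|x0] := leP 0 x.
  have y0 : 0 <= 2 * rho * x by rewrite !mulr_ge0// ltW.
  have := ler_wpM2l x0 (sinh_ge y0); lra.
have y0 : 0 <= - (2 * rho * x) by rewrite -mulrN mulr_ge0 ?oppr_ge0 ?ltW// mulr_gt0.
have x1 : 0 <= - x by rewrite oppr_ge0 ltW.
have := ler_wpM2l x1 (sinh_ge y0); rewrite opprK; lra.
Qed.

(** The second moment of the truncated discrete Gaussian is that of the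
    continuous one, up to a factor tending to [1] with [rho]: summing
    [gauss_difference] by parts leaves boundary terms of the right sign. *)
Lemma gauss_second_moment (R : realType) (rho : R) L : 0 < rho ->
  2 * rho * \sum_(k < L.*2.+1) centered R L k ^+ 2 * gauss rho (centered R L k) <=
  expR rho * gauss_mass rho L.
Proof.
move=> r0.
pose x (k : nat) := centered R L k.
pose U (k : nat) := x k * gauss rho (x k - 1) + (x k - 1) * gauss rho (x k).
have xS k : x k.+1 = x k + 1 by rewrite /x /centered -natr1; ring.
have tele n : \sum_(k < n) x k * (gauss rho (x k - 1) - gauss rho (x k + 1)) =
   \sum_(k < n) 2 * gauss rho (x k) + U 0%N - U n.
  elim: n => [|n IH]; first by rewrite !big_ord0; ring.
  rewrite !big_ord_recr/= IH /U xS addrK; ring.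
have U0 : U 0%N <= 0.
  have h : x 0%N = - L%:R by rewrite /x /centered sub0r.
  rewrite /U h; have := gauss_gt0 rho (- L%:R).
  have := mulr_ge0 (ler0n R L) (ltW (gauss_gt0 rho (- L%:R))).
  have := mulr_ge0 (ler0n R L) (ltW (gauss_gt0 rho (- L%:R - 1))).
  lra.
have Un : 0 <= U L.*2.+1.
  have h : x L.*2.+1 = L%:R + 1.
    by rewrite /x /centered -addnn -natr1 natrD; ring.
  rewrite /U h; have := gauss_gt0 rho (L%:R + 1 - 1).
  have := mulr_ge0 (ler0n R L) (ltW (gauss_gt0 rho (L%:R + 1))).
  have := mulr_ge0 (ler0n R L) (ltW (gauss_gt0 rho (L%:R + 1 - 1))).
  lra.
have H : \sum_(k < L.*2.+1) 4 * rho * expR (- rho) * (x k ^+ 2 * gauss rho (x k)) <=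
   2 * gauss_mass rho L.
  apply: le_trans (_ : \sum_(k < L.*2.+1) x k * (gauss rho (x k - 1) - gauss rho (x k + 1)) <= _).
    by apply: ler_sum => k _; exact: gauss_difference.
  rewrite tele -mulr_sumr -/(gauss_mass _ _); lra.
rewrite -mulr_sumr in H.
have e0 := expR_gt0 rho.
have := ler_wpM2l (ltW e0) H.
have -> : expR rho * (4 * rho * expR (- rho) *
     (\sum_(i < (L.*2).+1) x i ^+ 2 * gauss rho (x i))) =
   4 * rho * (expR rho * expR (- rho)) * (\sum_(i < (L.*2).+1) x i ^+ 2 * gauss rho (x i)).
  by ring.
rewrite -expRD subrr expR0 mulr1 -/(x _).
set S := \sum_(k < _) _; lra.
Qed.

Lemma gauss_massS (R : realType) (rho : R) L :
  gauss_mass rho L.+1 = gauss_mass rho L + 2 * gauss rho L.+1%:R.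
Proof.
rewrite /gauss_mass doubleS big_ord_recl big_ord_recr /=.
have -> : \sum_(i < (L.*2).+1) gauss rho (centered R L.+1 (bump 0 i)) =
          \sum_(i < (L.*2).+1) gauss rho (centered R L i).
  by apply: eq_bigr => i _; congr gauss; rewrite /centered /bump leq0n add1n -!natr1; ring.
have -> : centered R L.+1 0 = - L.+1%:R by rewrite /centered sub0r.
have -> : centered R L.+1 (bump 0 (L.*2).+1) = L.+1%:R.
  by rewrite /centered /bump leq0n add1n -doubleS -addnn natrD addrK.
rewrite /gauss sqrrN; ring.
Qed.

Lemma gauss_tail (R : realType) (rho : R) (L m : nat) : 0 < rho ->
  gauss_mass rho (L + m) <= gauss_mass rho L + (m.*2)%:R * gauss rho L%:R.
Proof.
move=> r0; elim: m => [|m IH]; first by rewrite addn0 mul0r addr0.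
rewrite addnS gauss_massS.
have h : gauss rho (L + m).+1%:R <= gauss rho L%:R.
  rewrite /gauss ler_expR lerN2 ler_pM2l// lerXn2r ?nnegrE ?ler0n// ler_nat.
  by rewrite leqW// leq_addr.
rewrite doubleS -(natr1 m.*2.+1) -(natr1 m.*2).
move: h IH; set a := gauss rho _; set b := gauss rho _; lra.
Qed.

(** Translating a lattice point by at most [m] may leave the box. If the box is
    large, the points between the two boxes weigh so little that this is
    harmless even in the product of [n] copies. *)
Lemma gauss_box (R : realType) (rho : R) (m n : nat) : 0 < rho ->
  exists L, gauss_mass rho (L + m) ^+ n <= expR 1 * gauss_mass rho L ^+ n.
Proof.
move=> r0; have [->|n0] := posnP n; first by exists 0%N; rewrite !expr0 mulr1 ltW// expR_gt1.
have n0' : 0 < n%:R :> R by rewrite ltr0n.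
pose L := (Num.truncn ((m.*2)%:R * n%:R / rho)).+1; exists L.
have hL : (m.*2)%:R * n%:R / rho <= L%:R.
  rewrite ltW// truncnS_gt//.
have mass1 : 1 <= gauss_mass rho L.
  rewrite /gauss_mass.
  have Lk : (L < L.*2.+1)%N by rewrite ltnS -addnn leq_addr.
  rewrite (bigD1 (Ordinal Lk))//= {1}/centered subrr {1}/gauss expr0n mulr0 oppr0 expR0.
  by rewrite lerDl sumr_ge0// => i _; rewrite ltW// gauss_gt0.
have tail : (m.*2)%:R * gauss rho L%:R <= n%:R^-1.
  rewrite -(ler_pM2r n0') mulVf ?gt_eqF// mulrAC.
  rewrite ler_pdivrMr// in hL.
  have L1 : 1 <= L%:R :> R by rewrite ler1n.
  rewrite /gauss expRN ler_pdivrMr ?expR_gt0// mul1r.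
  apply: le_trans (expR_ge1Dx _).
  have : 0 <= rho * (L%:R * (L%:R - 1)) by rewrite mulr_ge0 ?mulr_ge0 ?subr_ge0 ?ler0n// ltW.
  move: hL; set l : R := L%:R; lra.
have step : gauss_mass rho (L + m) <= gauss_mass rho L * (1 + n%:R^-1).
  apply: le_trans (gauss_tail L m r0) _; rewrite mulrDr mulr1 lerD2l.
  by apply: le_trans tail _; rewrite ler_peMl// invr_ge0 ltW.
have n1 : 0 <= 1 + n%:R^-1 :> R by rewrite addr_ge0// invr_ge0 ltW.
have mass0 k : 0 <= gauss_mass rho k by rewrite ltW// gauss_mass_gt0.
apply: le_trans (_ : (gauss_mass rho L * (1 + n%:R^-1)) ^+ n <= _).
  by rewrite lerXn2r// nnegrE// mulr_ge0.
rewrite exprMn mulrC ler_wpM2r ?exprn_ge0//.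
rewrite -[in leRHS](@mulfV _ (n%:R : R)) ?gt_eqF// expRM_natl.
by rewrite lerXn2r ?nnegrE ?expR_ge0// expR_ge1Dx.
Qed.

Definition lattice_pt (R : realType) (I : finType) (L : nat)
  (f : {ffun I -> 'I_L.*2.+1}) (i : I) : R := centered R L (f i).

Definition lattice_weight (R : realType) (I : finType) (rho : R) (L : nat)
  (f : {ffun I -> 'I_L.*2.+1}) : R := \prod_i gauss rho (lattice_pt R f i).

Lemma lattice_weight_gt0 (R : realType) (I : finType) (rho : R) L
  (f : {ffun I -> 'I_L.*2.+1}) : 0 < lattice_weight rho f.
Proof. by apply: prodr_gt0 => i _; exact: gauss_gt0. Qed.

Lemma lattice_mass (R : realType) (I : finType) (rho : R) L :
  \sum_(f : {ffun I -> 'I_L.*2.+1}) lattice_weight rho f = gauss_mass rho L ^+ #|I|.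
Proof.
rewrite /lattice_weight -(bigA_distr_bigA (fun (i : I) (k : 'I_L.*2.+1) => gauss rho (centered R L k))).
by rewrite prodr_const.
Qed.

(** Reversing the sign of one coordinate shows that distinct coordinates are
    uncorrelated; on the diagonal this is [gauss_second_moment] times the mass
    of the other coordinates. *)
Lemma lattice_correlation (R : realType) (I : finType) (rho : R) L (i i' : I) :
  0 < rho ->
  2 * rho * \sum_(f : {ffun I -> 'I_L.*2.+1})
     lattice_weight rho f * (lattice_pt R f i * lattice_pt R f i') <=
  (i == i')%:R * (expR rho * gauss_mass rho L ^+ #|I|) /\
  (i != i' -> \sum_(f : {ffun I -> 'I_L.*2.+1})
     lattice_weight rho f * (lattice_pt R f i * lattice_pt R f i') = 0).
Proof.
move=> r0.
have prod1 (F : I -> R) j : \prod_k (if k == j then F k else 1) = F j.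
  by rewrite -big_mkcond big_pred1_eq.
have -> : \sum_(f : {ffun I -> 'I_L.*2.+1})
     lattice_weight rho f * (lattice_pt R f i * lattice_pt R f i') =
  \prod_k \sum_(b < L.*2.+1) gauss rho (centered R L b) *
     ((if k == i then centered R L b else 1) * (if k == i' then centered R L b else 1)).
  rewrite (bigA_distr_bigA (fun k (b : 'I_L.*2.+1) => gauss rho (centered R L b) *
     ((if k == i then centered R L b else 1) * (if k == i' then centered R L b else 1)))).
  apply: eq_bigr => f _; rewrite big_split/=; congr (_ * _).
  by rewrite big_split/= !prod1.
have off : i != i' -> \prod_k \sum_(b < L.*2.+1) gauss rho (centered R L b) *
     ((if k == i then centered R L b else 1) * (if k == i' then centered R L b else 1)) = 0.
  move=> ii'; rewrite (bigD1 i)//= eqxx (negbTE ii').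
  suff -> : \sum_(b < L.*2.+1) gauss rho (centered R L b) * (centered R L b * 1) = 0.
    by rewrite mul0r.
  set S := LHS; suff : S = - S by move=> h; lra.
  rewrite {1}/S (reindex_inj rev_ord_inj)/= /S -sumrN; apply: eq_bigr => b _.
  have -> : centered R L ((L.*2).+1 - b.+1) = - centered R L b.
    have bL : (b <= L.*2)%N by rewrite -ltnS.
    have dL : (L.*2)%:R = L%:R + L%:R :> R by rewrite -addnn natrD.
    by rewrite /centered subSS natrB// dL; ring.
  by rewrite /gauss sqrrN; ring.
split=> //; have [ii'|/off ->] := eqVneq i i'; last by rewrite mulr0 mul0r.
rewrite mul1r -{}ii' (bigD1 i)//= eqxx -prodr_const [in leRHS](bigD1 i)//=.
rewrite mulrA [leRHS]mulrA ler_pM//.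
- apply: mulr_ge0; first by rewrite ltW// mulr_gt0.
  apply: sumr_ge0 => b _; rewrite -expr2.
  by rewrite mulr_ge0 ?sqr_ge0// ltW// gauss_gt0.
- apply: prodr_ge0 => k ki; apply: sumr_ge0 => b _; rewrite (negbTE ki).
  by rewrite !mulr1 ltW// gauss_gt0.
- apply: le_trans (gauss_second_moment L r0).
  rewrite ler_pM2l ?mulr_gt0//; apply: ler_sum => b _; rewrite mulrC expr2; exact: lexx.
- apply/ler_prod => k ki; rewrite (negbTE ki); apply/andP; split.
    by apply: sumr_ge0 => b _; rewrite !mulr1 ltW// gauss_gt0.
  by apply: ler_sum => b _; rewrite !mulr1.
Qed.

Lemma lattice_second_moment (R : realType) (I : finType) (rho : R) L (a : I -> R) :
  0 < rho ->
  2 * rho * \sum_(f : {ffun I -> 'I_L.*2.+1})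
     lattice_weight rho f * (\sum_i a i * lattice_pt R f i) ^+ 2 <=
  (\sum_i a i ^+ 2) * (expR rho * gauss_mass rho L ^+ #|I|).
Proof.
move=> r0.
have -> : \sum_(f : {ffun I -> 'I_L.*2.+1})
     lattice_weight rho f * (\sum_i a i * lattice_pt R f i) ^+ 2 =
  \sum_i \sum_i' a i * a i' * \sum_(f : {ffun I -> 'I_L.*2.+1})
     lattice_weight rho f * (lattice_pt R f i * lattice_pt R f i').
  under eq_bigr => f _ do rewrite expr2 big_distrlr/= mulr_sumr.
  rewrite exchange_big/=; apply: eq_bigr => i _.
  under eq_bigr => f _ do rewrite mulr_sumr.
  rewrite exchange_big/=; apply: eq_bigr => i' _.
  by rewrite mulr_sumr; apply: eq_bigr => f _; ring.
rewrite mulr_sumr mulr_suml; apply: ler_sum => i _.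
rewrite (bigD1 i)//= [X in _ + X]big1 ?addr0 => [|i' ii'].
  have [+ _] := lattice_correlation L i i r0; rewrite eqxx mul1r => h.
  have := ler_wpM2l (sqr_ge0 (a i)) h; rewrite -expr2.
  set S := \sum_(_ | _) _; lra.
by have [_ ->] := lattice_correlation L i i' r0; rewrite ?mulr0// eq_sym.
Qed.

Lemma lattice_weightE (R : realType) (I : finType) (rho : R) L
    (f : {ffun I -> 'I_L.*2.+1}) :
  lattice_weight rho f = expR (- (rho * \sum_i lattice_pt R f i ^+ 2)).
Proof. by rewrite /lattice_weight /gauss -expR_sum sumrN mulr_sumr. Qed.

(** The mean of the weights of [t + f] and [t - f] is [exp (- rho |t|^2)] times the
    weight of [f] times a hyperbolic cosine, and [cosh >= 1]; a symmetric set
    [S0] contains [f] and [-f] together. *)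
Lemma lattice_shift (R : realType) (I : finType) (rho : R) (m L : nat)
    (t : {ffun I -> 'I_m.*2.+1}) (S0 : {set {ffun I -> 'I_L.*2.+1}})
    (Q : {ffun I -> 'I_(L + m).*2.+1} -> bool) :
  (forall f f', (forall i, lattice_pt R f' i = - lattice_pt R f i) ->
     f \in S0 -> f' \in S0) ->
  (forall f c, (forall i, lattice_pt R c i = lattice_pt R t i + lattice_pt R f i) ->
     f \in S0 -> Q c) ->
  lattice_weight rho t * \sum_(f in S0) lattice_weight rho f <=
  \sum_(c | Q c) lattice_weight rho c.
Proof.
move=> symS0 QS0.
have sumlt (f : {ffun I -> 'I_L.*2.+1}) i : (t i + f i < (L + m).*2.+1)%N.
  rewrite ltnS doubleD addnC leq_add//; [have := ltn_ord (f i)|have := ltn_ord (t i)].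
    by rewrite ltnS.
  by rewrite ltnS.
pose h (f : {ffun I -> 'I_L.*2.+1}) := [ffun i => Ordinal (sumlt f i)].
pose neg (f : {ffun I -> 'I_L.*2.+1}) := [ffun i => rev_ord (f i)].
have ptneg f i : lattice_pt R (neg f) i = - lattice_pt R f i.
  rewrite /lattice_pt /centered ffunE /= subSS.
  have bL : (f i <= L.*2)%N by rewrite -ltnS.
  have dL : (L.*2)%:R = L%:R + L%:R :> R by rewrite -addnn natrD.
  by rewrite natrB// dL; ring.
have pth f i : lattice_pt R (h f) i = lattice_pt R t i + lattice_pt R f i.
  by rewrite /lattice_pt /centered ffunE/= !natrD; ring.
have negK : involutive neg by move=> f; apply/ffunP => i; rewrite !ffunE rev_ordK.
have hinj : injective h.
  move=> f f' /ffunP E; apply/ffunP => i; have := E i; rewrite !ffunE => -[] /addnI.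
  exact: val_inj.
have negS0 f : (neg f \in S0) = (f \in S0).
  apply/idP/idP => [|]; first by apply: symS0 => i; rewrite ptneg opprK.
  by apply: symS0 => i; rewrite ptneg.
have weight_h f : lattice_weight rho t * lattice_weight rho f *+ 2 <=
    lattice_weight rho (h f) + lattice_weight rho (h (neg f)).
  rewrite !lattice_weightE -expRD.
  under [X in _ <= expR (- (_ * X)) + _]eq_bigr => i _ do rewrite pth sqrrD.
  under [X in _ <= _ + expR (- (_ * X))]eq_bigr => i _ do rewrite pth ptneg sqrrB.
  rewrite !big_split/= sumrN.
  rewrite sumrMnl mulr2n.
  set a := \sum_i lattice_pt R t i ^+ 2; set b := \sum_i lattice_pt R f i ^+ 2.
  set p := \sum_i lattice_pt R t i * lattice_pt R f i; set d := p + p.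
  have -> : - (rho * (a + d + b)) = - (rho * a) - (rho * b) - rho * d by ring.
  have -> : - (rho * (a - d + b)) = - (rho * a) - (rho * b) + rho * d by ring.
  rewrite [expR (_ - rho * d)]expRD [expR (_ + rho * d)]expRD -mulrDr -mulr_natr.
  rewrite ler_wpM2l ?expR_ge0//.
  by have := expR_ge1Dx (rho * d); have := expR_ge1Dx (- (rho * d)); lra.
have E : \sum_(f in S0) lattice_weight rho (h (neg f)) =
         \sum_(f in S0) lattice_weight rho (h f).
  rewrite (reindex_inj (inv_inj negK))/=.
  by apply: eq_big => [f|f _]; rewrite ?negS0// negK.
have : \sum_(f in S0) lattice_weight rho (h f) <= \sum_(c | Q c) lattice_weight rho c.
  have -> : \sum_(f in S0) lattice_weight rho (h f) =
            \sum_(c in (h @: S0)%SET) lattice_weight rho c.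
    by rewrite big_imset//= => f f' _ _; exact: hinj.
  rewrite [leRHS](bigID (fun c => c \in (h @: S0)%SET))/=.
  rewrite (eq_bigl (fun c => Q c && (c \in (h @: S0)%SET))).
    by rewrite lerDl sumr_ge0// => c _; rewrite ltW// lattice_weight_gt0.
  move=> c; apply/idP/andP => [cS|[]//]; split=> //.
  by have /imsetP[f fS0 ->] := cS; apply: QS0 fS0 => i.
apply: le_trans; rewrite mulr_sumr.
rewrite -(ler_pM2r (_ : 0 < 2%:R :> R))//.
have -> : (\sum_(f in S0) lattice_weight rho (h f)) * 2 =
   \sum_(f in S0) (lattice_weight rho (h f) + lattice_weight rho (h (neg f))).
  by rewrite big_split/= E; ring.
rewrite mulr_suml; apply: ler_sum => f _; rewrite mulr_natr; exact: weight_h.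
Qed.

(** * Covering the unit ball by few ellipsoids *)

(** Lovasz's greedy covering: if each target is covered by a fraction [w0 / W]
    of the total weight of the codewords, some codeword covers that fraction of
    the targets not covered yet. *)
Lemma greedy_cover (R : realType) (T C : finType) (cov : C -> T -> bool)
    (w : C -> R) (w0 W : R) (n : nat) :
  0 < w0 -> 0 < W -> (forall c, 0 < w c) -> \sum_c w c <= W ->
  (forall t, w0 <= \sum_(c | cov c t) w c) ->
  #|T|%:R * (1 - w0 / W) ^+ n < 1 ->
  exists2 s : seq C, (size s <= n)%N & forall t, has (cov^~ t) s.
Proof.
move=> w00 W0 wpos wW wcov small.
pose U (s : seq C) := [set t | ~~ has (cov^~ t) s]%SET.
have step (s : seq C) : exists s' : seq C, (size s' <= (size s).+1)%N /\
    #|U s'|%:R <= #|U s|%:R * (1 - w0 / W).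
  have [U0|Un0] := eqVneq (U s) finset.set0.
    by exists s; rewrite leqnSn U0 cards0 mul0r.
  have U1 : 0 < #|U s|%:R :> R by rewrite ltr0n card_gt0.
  have [c hc] : exists c, w0 / W * #|U s|%:R <= #|[set t in U s | cov c t]%SET|%:R.
    apply: contrapT => /forallNP no.
    have low : w0 * #|U s|%:R <= \sum_c w c * #|[set t in U s | cov c t]%SET|%:R.
      have -> : \sum_c w c * #|[set t in U s | cov c t]%SET|%:R =
                \sum_(t in U s) \sum_(c | cov c t) w c.
        rewrite (exchange_big_dep xpredT)//=; apply: eq_bigr => c _.
        rewrite sumr_const mulr_natr; congr (_ *+ _).
        by apply: eq_card => t; rewrite inE.
      rewrite mulr_natr -sumr_const; apply: ler_sum => t _; exact: wcov.
    have [t _] : exists t, t \in U s by apply/finset.set0Pn.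
    have := wcov t.
    have [c0 _ _|C0] := pickP (fun c : C => true); last first.
      by rewrite big1 ?leNgt ?w00// => c; have := C0 c.
    have hi : \sum_c w c * #|[set t in U s | cov c t]%SET|%:R <
              \sum_c w c * (w0 / W * #|U s|%:R).
      apply: ltr_sum => [|c _]; first by apply/hasP; exists c0; rewrite ?mem_index_enum.
      by rewrite ltr_pM2l ?wpos// ltNge; apply/negP/no.
    suff hi2 : \sum_c w c * (w0 / W * #|U s|%:R) <= w0 * #|U s|%:R.
      by have := lt_le_trans (le_lt_trans low hi) hi2; rewrite ltxx.
    rewrite -mulr_suml mulrA ler_pM2r// mulrCA; apply: ler_piMr; first exact: ltW.
    by rewrite ler_pdivrMr// mul1r.
  exists (c :: s); split => //=.
  have -> : U (c :: s) = (U s :\: [set t in U s | cov c t])%SET.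
    by apply/setP => t; rewrite !inE /= negb_or; case: (cov c t); case: (has _ _).
  rewrite cardsD (finset.setIidPr _); last by apply/fintype.subsetP => t; rewrite inE => /andP[].
  rewrite natrB; last by apply/subset_leq_card/fintype.subsetP => t; rewrite inE => /andP[].
  by move: hc; rewrite mulrBr mulr1 [_ * (w0 / W)]mulrC; lra.
have [s [sn hs]] : exists s : seq C, (size s <= n)%N /\
    #|U s|%:R <= #|T|%:R * (1 - w0 / W) ^+ n.
  have ge0 : #|T| != 0%N -> 0 <= 1 - w0 / W.
    move=> T0; have [t _|] := pickP (fun t : T => true); last first.
      by move=> /eq_card0 h; move: T0; rewrite -(eq_card (_ : [pred t : T | true] =i _)) ?h.
    rewrite subr_ge0 ler_pdivrMr// mul1r (le_trans (wcov t))//.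
    apply: le_trans wW; rewrite [leRHS](bigID (fun c => cov c t))/= lerDl sumr_ge0// => c _.
    exact: ltW.
  elim: n {small} => [|n [s [sn hs]]].
    by exists [::]; split => //; rewrite expr0 mulr1 ler_nat max_card.
  have [s' [ss hs']] := step s; exists s'; split; first exact: leq_trans ss _.
  apply: le_trans hs' _; have [T0|/ge0 h] := eqVneq #|T| 0%N.
    have : (#|U s| <= #|T|)%N by exact: max_card.
    by rewrite T0 leqn0 => /eqP ->; rewrite !mul0r.
  by rewrite exprSr mulrA ler_wpM2r.
exists s => // t; apply: contrapT => /negP tU.
have : (0 < #|U s|)%N by rewrite card_gt0; apply/finset.set0Pn; exists t; rewrite inE.
rewrite -(ltr0n R) => U1; have := le_lt_trans hs small.
by rewrite -[1]/(1%:R) ltr_nat ltnS leqn0 => /eqP h; move: U1; rewrite h ltxx.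
Qed.

Lemma expR1_le4 (R : realType) : expR 1 <= 4 :> R.
Proof.
have -> : 1 = 2%:R * 2^-1 :> R by rewrite mulfV.
have := expR_ge1Dx (- 2^-1 : R); rewrite expRN expRM_natl => h.
have e0 := expR_gt0 (2^-1 : R).
have : expR 2^-1 <= 2 :> R.
  have := ler_wpM2r (ltW e0) h; rewrite mulVf ?gt_eqF//; lra.
move: e0; set x := expR _; rewrite expr2; nra.
Qed.

(** Counting the codewords in [ellipsoid_cover]: everything polynomial in the
    dimension and in [K] is absorbed by a small exponential of [K]. *)
Lemma codeword_count (R : realType) (K n m : R) :
  500 <= K -> 1 <= n -> n <= expR (K / 100) -> 0 <= m -> m <= 50 * n * K + 1 ->
  5 * expR (K / 2 * (51/50) ^+ 2 + 1) * (2 * m * n + 1) + 1 <= expR (3 / 5 * K).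
Proof.
move=> K5 n1 nK m0 mK.
have n2 : n ^+ 2 <= expR (K / 50).
  have -> : K / 50 = 2%:R * (K / 100) by field.
  by rewrite expRM_natl lerXn2r// nnegrE ?expR_ge0//; lra.
have h1 : 2 * m * n + 1 <= 103 * (n ^+ 2 * K).
  have : n * m <= n * (50 * n * K + 1) by rewrite ler_wpM2l//; lra.
  have : n <= n ^+ 2 by rewrite expr2; nra.
  have : n ^+ 2 * 500 <= n ^+ 2 * K by rewrite ler_wpM2l// sqr_ge0.
  have : 1 <= n ^+ 2 by rewrite expr2; nra.
  lra.
set E := expR (K / 2 * (51/50) ^+ 2).
have E1 : 1 <= E by rewrite -[leLHS]expR0 ler_expR; apply: mulr_ge0; [lra|exact: sqr_ge0].
have h2 : expR (K / 2 * (51/50) ^+ 2 + 1) <= 4 * E.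
  by rewrite expRD mulrC ler_wpM2r ?expR_ge0// expR1_le4.
have y7 : 1546 * 20 * (K / 20) * (4/3) <= expR (K / 20).
  have y0 : 0 <= K / 20 by lra.
  apply: le_trans (expR_ge1Dxn 6 y0).
  have -> : (7`!)%:R = 5040 :> R by rewrite !factS fact0.
  have y25 : 25 <= K / 20 by lra.
  have y6 : 25 ^+ 6 <= (K / 20) ^+ 6 by rewrite lerXn2r// nnegrE; lra.
  have : K / 20 * 25 ^+ 6 <= K / 20 * (K / 20) ^+ 6 by rewrite ler_wpM2l.
  rewrite -exprS; set z := (K / 20) ^+ 7; lra.
have E0 : 0 <= E by lra.
apply: le_trans (_ : 5 * (4 * E) * (103 * (n ^+ 2 * K)) + 1 <= _).
  have p0 : 0 <= 2 * m * n + 1.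
    by apply: addr_ge0 => //; apply: mulr_ge0; [apply: mulr_ge0|lra].
  have e0 : 0 <= 5 * expR (K / 2 * (51 / 50) ^+ 2 + 1).
    by apply: mulr_ge0 => //; exact: expR_ge0.
  by rewrite lerD2r; apply: ler_pM => //; rewrite ler_pM2l.
apply: le_trans (_ : E * (expR (K / 50) * expR (K / 20)) <= _); last first.
  by rewrite -!expRD ler_expR; lra.
have : 2061 * (n ^+ 2 * K) <= expR (K / 50) * expR (K / 20).
  apply: le_trans (_ : expR (K / 50) * (2061 * K) <= _).
    by rewrite mulrCA; apply: ler_wpM2r; [lra|exact: n2].
  by apply: ler_wpM2l; [exact: expR_ge0|lra].
move=> /(ler_wpM2l E0); apply: le_trans.
have : 1 <= n ^+ 2 * K by rewrite expr2; nra.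
move=> /(ler_wpM2l E0); set x := n ^+ 2 * K; lra.
Qed.

Lemma sqr_sum_le (R : realType) (I : finType) (a b : I -> R) :
  (\sum_i a i * b i) ^+ 2 <= (\sum_i a i ^+ 2) * (\sum_i b i ^+ 2).
Proof.
have : 0 <= \sum_i \sum_i' (a i * b i' - a i' * b i) ^+ 2.
  by apply: sumr_ge0 => i _; apply: sumr_ge0 => i' _; exact: sqr_ge0.
have -> : \sum_i \sum_i' (a i * b i' - a i' * b i) ^+ 2 =
   2 * ((\sum_i a i ^+ 2) * (\sum_i b i ^+ 2)) - 2 * (\sum_i a i * b i) ^+ 2.
  have -> : \sum_i \sum_i' (a i * b i' - a i' * b i) ^+ 2 =
    \sum_i \sum_i' a i ^+ 2 * b i' ^+ 2 + \sum_i \sum_i' b i ^+ 2 * a i' ^+ 2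
    - 2 * \sum_i \sum_i' (a i * b i) * (a i' * b i').
    rewrite mulr_sumr -!big_split -sumrB/=; apply: eq_bigr => i _.
    by rewrite mulr_sumr -big_split -sumrB/=; apply: eq_bigr => i' _; ring.
  rewrite expr2 !big_distrlr/= [\sum_i \sum_i' b i ^+ 2 * _]exchange_big/=.
  have -> : \sum_(j : I) \sum_i b i ^+ 2 * a j ^+ 2 = \sum_i \sum_i' a i ^+ 2 * b i' ^+ 2.
    by apply: eq_bigr => i _; apply: eq_bigr => i' _; rewrite mulrC.
  ring.
by move=> h; lra.
Qed.

Definition sqnorm_image (R : realType) (I J : finType) (E : J -> I -> R) (y : I -> R) : R :=
  \sum_j (\sum_i E j i * y i) ^+ 2.

Lemma sqnorm_imageZ (R : realType) (I J : finType) (E : J -> I -> R) (c : R) (y z : I -> R) :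
  (forall i, z i = c * y i) -> sqnorm_image E z = c ^+ 2 * sqnorm_image E y.
Proof.
move=> zE; rewrite /sqnorm_image mulr_sumr; apply: eq_bigr => j _.
rewrite -exprMn mulr_sumr; congr (_ ^+ 2); apply: eq_bigr => i _.
by rewrite zE mulrCA.
Qed.

Lemma sqnorm_image_le (R : realType) (I J : finType) (E : J -> I -> R) (y : I -> R) :
  sqnorm_image E y <= (\sum_j \sum_i E j i ^+ 2) * \sum_i y i ^+ 2.
Proof.
by rewrite mulr_suml; apply: ler_sum => j _; exact: sqr_sum_le.
Qed.

(** The triangle inequality for squared norms. The cross term is bounded by
    Cauchy-Schwarz, so that no square root has to be taken. *)
Lemma sqnorm_image_triangle (R : realType) (I J : finType) (E : J -> I -> R)
    (y z : I -> R) (eta th : R) : 0 <= eta -> 0 <= th <= 1 ->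
  sqnorm_image E y <= ((1 - th) * eta) ^+ 2 -> sqnorm_image E z <= (th * eta) ^+ 2 ->
  sqnorm_image E (fun i => y i + z i) <= eta ^+ 2.
Proof.
move=> e0 /andP[t0 t1] hy hz.
have -> : sqnorm_image E (fun i => y i + z i) = sqnorm_image E y + sqnorm_image E z +
    2 * \sum_j (\sum_i E j i * y i) * (\sum_i E j i * z i).
  rewrite /sqnorm_image mulr_sumr -!big_split/=; apply: eq_bigr => j _.
  under eq_bigr => i _ do rewrite mulrDr.
  by rewrite big_split/=; ring.
set S := \sum_j _.
have S2 : S ^+ 2 <= ((1 - th) * th * eta ^+ 2) ^+ 2.
  apply: le_trans (sqr_sum_le _ _) _.
  have -> : ((1 - th) * th * eta ^+ 2) ^+ 2 = ((1 - th) * eta) ^+ 2 * (th * eta) ^+ 2 by ring.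
  by apply: ler_pM => //; apply: sumr_ge0 => j _; exact: sqr_ge0.
have S1 : S <= (1 - th) * th * eta ^+ 2.
  have p0 : 0 <= (1 - th) * th * eta ^+ 2 by rewrite !mulr_ge0 ?sqr_ge0// subr_ge0.
  by apply: le_trans (ler_norm _) _; rewrite -ler_sqr ?nnegrE// real_normK ?num_real.
move: hy hz S1; set a := sqnorm_image _ _; set b := sqnorm_image _ _ => hy hz S1.
have : eta ^+ 2 = ((1 - th) * eta) ^+ 2 + (th * eta) ^+ 2 + 2 * ((1 - th) * th * eta ^+ 2).
  by ring.
move=> ->; lra.
Qed.

(** A form of the dual Sudakov inequality. The centres are drawn from a discrete
    Gaussian on a fine lattice, with variance about [1 / K]. At least a fifth of
    the weight lies where [E] is smaller than [eta] ([lattice_second_moment] and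
    Chebyshev's inequality). Translating this symmetric set by a vector of norm
    at most one costs a factor of about [exp (- K / 2)] of its weight
    ([lattice_shift]), and the greedy argument turns this fraction into a cover.
    The bound [Gamma] on the coordinates of the centres comes before the operator
    because [half_step] needs it to choose the radii for which its first-order
    estimates hold. *)
Lemma ellipsoid_cover (R : realType) (I : finType) (K : R) :
  (0 < #|I|)%N -> 500 <= K -> #|I|%:R <= expR (K / 100) ->
  exists2 Gamma : R, 0 < Gamma & forall (J : finType) (E : J -> I -> R) (eta : R),
    0 < eta -> \sum_j \sum_i E j i ^+ 2 <= 3 / 4 * K * eta ^+ 2 ->
    exists (T : finType) (g : T -> I -> R),
      [/\ #|T|%:R <= expR (3 / 5 * K),
          forall a i, `|g a i| <= Gamma &
          forall x, \sum_i x i ^+ 2 <= 1 ->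
            exists a, sqnorm_image E (fun i => x i - g a i) <= eta ^+ 2].
Proof.
move=> I0 K5 IK; set n : R := #|I|%:R.
have n1 : 1 <= n by rewrite /n ler1n.
have K0 : 0 < K by lra.
(* The lattice has mesh [1 / q] in the unit ball, and [rho] is chosen such that
   the Gaussian in unit coordinates is [exp (- K / 2 * |x|^2)]. *)
pose q : R := 50 * n * K.
have q0 : 0 < q by rewrite /q !mulr_gt0//; lra.
have q1 : 1 <= q by rewrite /q; nra.
pose m := (Num.truncn q).+1.
have mq : q < m%:R by rewrite truncnS_gt.
have mq1 : m%:R <= q + 1.
  by rewrite -natr1 lerD2r truncn_le ltW.
pose rho : R := K / 2 / q ^+ 2.
have rho0 : 0 < rho by rewrite !divr_gt0// exprn_gt0.
have rhoq : rho * q ^+ 2 = K / 2 by rewrite divfK// expf_neq0// gt_eqF.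
have [L HL] := gauss_box m #|I| rho0.
exists ((L + m)%:R / q); first by rewrite divr_gt0// ltr0n addnS.
move=> J E eta eta0 hE.
pose Z := gauss_mass rho L ^+ #|I|.
have Z0 : 0 < Z by rewrite exprn_gt0// gauss_mass_gt0.
pose good (t : {ffun I -> 'I_m.*2.+1}) := rho * (\sum_i lattice_pt R t i ^+ 2) <= K / 2 * (51/50) ^+ 2.
(* It is enough to cover the lattice points of a slightly larger ball, with
   slightly smaller balls: rounding the target costs a share [1 / 50] of the
   radius. *)
pose T : finType := {: {t : {ffun I -> 'I_m.*2.+1} | good t}}.
pose C := {ffun I -> 'I_(L + m).*2.+1}.
pose cov (c : C) (t : T) := sqnorm_image E (fun i => (lattice_pt R (val t) i - lattice_pt R c i) / q)
   <= ((1 - 50^-1) * eta) ^+ 2.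
pose S0 := [set f : {ffun I -> 'I_L.*2.+1} |
  sqnorm_image E (fun i => lattice_pt R f i / q) <= ((1 - 50^-1) * eta) ^+ 2]%SET.
have S0mass : Z / 5 <= \sum_(f in S0) lattice_weight rho f.
  have B0 : 0 < ((1 - 50^-1) * eta) ^+ 2 by rewrite exprn_gt0// mulr_gt0//; lra.
  have tot := lattice_mass I rho L; rewrite -/Z in tot.
  have split := bigID (fun f => f \in S0) xpredT (fun f => lattice_weight rho f).
  rewrite split/= in tot.
  pose M := \sum_(f : {ffun I -> 'I_L.*2.+1})
        lattice_weight rho f * sqnorm_image E (fun i => lattice_pt R f i / q).
  have out : (\sum_(f | f \notin S0) lattice_weight rho f) * ((1 - 50^-1) * eta) ^+ 2 <= M.
    rewrite /M mulr_suml [leRHS](bigID (fun f => f \notin S0))/= ler_wpDr//.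
      apply: sumr_ge0 => f _; rewrite mulr_ge0 ?(ltW (lattice_weight_gt0 _ _))//.
      by apply: sumr_ge0 => j _; exact: sqr_ge0.
    apply: ler_sum => f; rewrite inE -ltNge => /ltW h.
    by rewrite ler_wpM2l// ltW// lattice_weight_gt0.
  have mom : 2 * rho * M <=
      q ^- 2 * ((\sum_j \sum_i E j i ^+ 2) * (expR rho * Z)).
    have -> : M =
      q ^- 2 * \sum_j \sum_(f : {ffun I -> 'I_L.*2.+1})
        lattice_weight rho f * (\sum_i E j i * lattice_pt R f i) ^+ 2.
      rewrite exchange_big/= /M mulr_sumr; apply: eq_bigr => f _.
      rewrite (@sqnorm_imageZ _ _ _ _ q^-1 (lattice_pt R f)); last by move=> i; rewrite mulrC.
      by rewrite exprVn mulrCA /sqnorm_image mulr_sumr.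
    rewrite mulrCA ler_pM2l ?invr_gt0 ?exprn_gt0// mulr_sumr mulr_suml.
    by apply: ler_sum => j _; exact: lattice_second_moment.
  have q2 : 0 < q ^+ 2 by rewrite exprn_gt0.
  have rhoE : 2 * rho = q ^- 2 * K by rewrite /rho; field; rewrite gt_eqF.
  have erho : expR rho <= 100 / 99.
    have r1 : rho <= 1 / 100.
      rewrite /rho ler_pdivrMr//.
      have nK : K <= n * K by rewrite ler_peMl// ltW.
      have : K * K <= (n * K) * (n * K) by apply: ler_pM => //; move: K0; goal_lra.
      have : 500 * K <= K * K by rewrite ler_wpM2r//; move: K0; goal_lra.
      by rewrite /q !exprMn; move: K0; goal_lra.
    have := expR_ge1Dx (- rho); rewrite expRN => h.
    have := ler_wpM2r (expR_ge0 rho) h; rewrite mulVf ?gt_eqF ?expR_gt0//.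
    by have := expR_gt0 rho; nra.
  rewrite rhoE -(mulrA _ K M) ler_pM2l ?invr_gt0// in mom.
  move: out mom tot; set S := \sum_(f | _ \notin _) _.
  move=> out mom tot.
  have : K * M <= K * (3 / 4 * eta ^+ 2 * (100 / 99 * Z)).
    apply: le_trans mom _; apply: le_trans (_ : (3 / 4 * K * eta ^+ 2) * (100 / 99 * Z) <= _).
      apply: ler_pM => //.
      - by apply: sumr_ge0 => j _; apply: sumr_ge0 => i _; exact: sqr_ge0.
      - by rewrite mulr_ge0 ?expR_ge0// ltW.
      - by rewrite ler_pM2r.
    by rewrite le_eqVlt; apply/orP; left; apply/eqP; ring.
  rewrite ler_pM2l// => hM.
  have : eta ^+ 2 * (S * (1 - 50^-1) ^+ 2) <= eta ^+ 2 * (3 / 4 * (100 / 99 * Z)).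
    by have := le_trans out hM; rewrite exprMn; goal_lra.
  by rewrite ler_pM2l ?exprn_gt0//; move: tot Z0; goal_lra.
pose w0 := expR (- (K / 2 * (51/50) ^+ 2)) * (Z / 5).
have w00 : 0 < w0 by rewrite mulr_gt0 ?expR_gt0// divr_gt0.
pose W := expR 1 * Z.
have W0 : 0 < W by rewrite mulr_gt0 ?expR_gt0.
pose N := (Num.truncn (W / w0 * (2 * m%:R * n + 1))).+1.
have [||||s sN covs] := @greedy_cover R T C cov (fun c => lattice_weight rho c) w0 W N w00 W0.
- by move=> c; exact: lattice_weight_gt0.
- by rewrite lattice_mass.
- move=> t; apply: le_trans (_ : lattice_weight rho (val t) *
     \sum_(f in S0) lattice_weight rho f <= _).
    apply: ler_pM => //; [by rewrite divr_ge0// ltW|].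
    by rewrite lattice_weightE ler_expR lerN2; exact: (valP t).
  have negE (y z : I -> R) : (forall i, z i = - y i) -> sqnorm_image E z = sqnorm_image E y.
    move=> zy; rewrite (@sqnorm_imageZ _ _ _ _ (-1) y) ?sqrrN ?expr1n ?mul1r//.
    by move=> i; rewrite zy mulN1r.
  apply: lattice_shift => [f f' ff'|f c cE]; rewrite !inE /cov.
    rewrite [X in _ -> X <= _](negE (fun i => lattice_pt R f i / q))// => i.
    by rewrite ff' mulNr.
  rewrite [X in _ -> X <= _](negE (fun i => lattice_pt R f i / q))// => i.
  by rewrite cE; ring.
- have wW : w0 <= W.
    rewrite /w0 /W -[Z / 5]mulrC mulrA ler_pM2r//.
    have : expR (- (K / 2 * (51 / 50) ^+ 2)) <= expR 1 :> R.
      rewrite ler_expR; have := sqr_ge0 (51/50 : R); nra.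
    by have := expR_gt0 (- (K / 2 * (51 / 50) ^+ 2) : R); lra.
  have T1 : #|T|%:R <= expR (2 * m%:R * n) :> R.
    apply: le_trans (_ : (m.*2.+1 ^ #|I|)%:R <= _).
      by rewrite ler_nat card_sig (leq_trans (max_card _))// card_ffun card_ord.
    rewrite natrX mulrC expRM_natl lerXn2r ?nnegrE ?expR_ge0//.
    by apply: le_trans (expR_ge1Dx _); rewrite -natr1 -mul2n natrM addrC.
  have N1 : 2 * m%:R * n + 1 < w0 / W * N%:R.
    rewrite -ltr_pdivrMl ?divr_gt0// invf_div; exact: truncnS_gt.
  have x1 : 0 <= 1 - w0 / W by rewrite subr_ge0 ler_pdivrMr// mul1r.
  apply: le_lt_trans (_ : expR (2 * m%:R * n) * expR (- (w0 / W)) ^+ N < 1).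
    apply: ler_pM => //; first exact: exprn_ge0.
    by rewrite lerXn2r ?nnegrE ?expR_ge0//; apply: expR_ge1Dx.
  rewrite -expRM_natl -expRD expR_lt1; move: N1; rewrite mulrN [N%:R * _]mulrC; lra.
exists 'I_(size s), (fun a i => lattice_pt R (tnth (in_tuple s) a) i / q); split.
- rewrite card_ord; apply: le_trans (codeword_count K5 n1 IK (ler0n R m) mq1).
  apply: le_trans (_ : N%:R <= _); first by rewrite ler_nat.
  rewrite /N -[X in X <= _]natr1 lerD2r.
  have -> : 5 * expR (K / 2 * (51 / 50) ^+ 2 + 1) = W / w0.
    rewrite /W /w0 expRN expRD; field.
    by rewrite !gt_eqF ?expR_gt0.
  rewrite truncn_le// mulr_ge0 ?divr_ge0 ?ltW//.
  by rewrite addr_gt0// !mulr_gt0// ?ltr0n//; lra.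
- move=> a i; rewrite normrM normfV (gtr0_norm q0) ler_pM2r ?invr_gt0//.
  rewrite /lattice_pt /centered; set c := tnth _ _; set k := c i.
  have : (k <= (L + m).*2)%N by rewrite -ltnS.
  have dd : ((L + m).*2)%:R = (L + m)%:R + (L + m)%:R :> R by rewrite -addnn natrD.
  rewrite -(ler_nat R) dd ler_norml => h.
  by have := ler0n R k; move: h => h k0; apply/andP; split; move: h k0; goal_lra.
- move=> x x1.
  have xq i : 0 <= x i * q + m%:R <= m%:R + m%:R.
    have : x i ^+ 2 <= 1.
      apply: le_trans x1; rewrite (bigD1 i)//= lerDl sumr_ge0// => k _; exact: sqr_ge0.
    by rewrite expr2 => h; nra.
  have kb i : (Num.truncn (x i * q + m%:R) < m.*2.+1)%N.
    have /andP[h0 h1] := xq i.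
    by rewrite ltnS -(ler_nat R) -addnn natrD (le_trans _ h1)// truncn_le.
  pose t : {ffun I -> 'I_m.*2.+1} := [ffun i => Ordinal (kb i)].
  have tx i : 0 <= x i - lattice_pt R t i / q <= q^-1.
    have /andP[h0 h1] := xq i.
    have : (Num.truncn (x i * q + m%:R))%:R <= x i * q + m%:R by rewrite truncn_le.
    have : x i * q + m%:R < (Num.truncn (x i * q + m%:R)).+1%:R by rewrite truncnS_gt.
    rewrite -natr1 /lattice_pt /centered ffunE/=; set k := (Num.truncn _)%:R => ha hb.
    have -> : x i - (k - m%:R) / q = (x i * q - (k - m%:R)) / q by field; rewrite gt_eqF.
    rewrite divr_ge0 ?(ltW q0)//=; last by move: hb; goal_lra.
    by rewrite ler_pdivrMr// mulVf ?gt_eqF//; move: ha; goal_lra.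
  have d2 : \sum_i (x i - lattice_pt R t i / q) ^+ 2 <= n / q ^+ 2.
    apply: le_trans (_ : \sum_(i : I) q ^- 2 <= _); last by rewrite sumr_const mulr_natl.
    apply: ler_sum => i _; have /andP[h0 h1] := tx i.
    by rewrite -exprVn lerXn2r// nnegrE// invr_ge0 ltW.
  have nq : n / q ^+ 2 * K <= 1 / 2500.
    rewrite mulrAC ler_pdivrMr ?exprn_gt0// /q !exprMn.
    have nK1 : 1 <= n * K by rewrite -[leLHS]mul1r; apply: ler_pM => //; move: K5; goal_lra.
    have : n * K * 1 <= n * K * (n * K) by rewrite ler_wpM2l//; move: nK1; goal_lra.
    goal_lra.
  have tgood : good t.
    rewrite /good.
    have -> : \sum_i lattice_pt R t i ^+ 2 = q ^+ 2 * \sum_i (lattice_pt R t i / q) ^+ 2.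
      rewrite mulr_sumr; apply: eq_bigr => i _.
      by rewrite expr_div_n mulrC divfK// expf_neq0// gt_eqF.
    rewrite mulrA rhoq ler_pM2l ?divr_gt0//.
    have idE (y : I -> R) : sqnorm_image (fun j i => (i == j)%:R) y = \sum_i y i ^+ 2.
      apply: eq_bigr => j _; congr (_ ^+ 2).
      by rewrite (bigD1 j)//= eqxx mul1r big1 ?addr0// => i /negbTE ->; rewrite mul0r.
    have := @sqnorm_image_triangle R I I (fun j i => (i == j)%:R) x
       (fun i => - (x i - lattice_pt R t i / q)) (51 / 50) (51^-1).
    rewrite !idE => h.
    have -> : \sum_i (lattice_pt R t i / q) ^+ 2 =
       \sum_i (x i - (x i - lattice_pt R t i / q)) ^+ 2.
      by apply: eq_bigr => i _; rewrite subKr.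
    apply: h; [goal_lra|goal_lra|by apply: le_trans x1 _; goal_lra|].
    under eq_bigr do rewrite sqrrN.
    apply: le_trans d2 _.
    have : n / q ^+ 2 * 500 <= n / q ^+ 2 * K.
      by rewrite ler_wpM2l// divr_ge0 ?sqr_ge0//; move: n1; goal_lra.
    by move: nq; goal_lra.
  have /hasP[c cs ct] := covs (exist _ t tgood).
  have cn : (index c s < size s)%N by rewrite index_mem.
  exists (Ordinal cn); rewrite (tnth_nth c)/= nth_index//.
  have := @sqnorm_image_triangle R I J E (fun i => (lattice_pt R t i - lattice_pt R c i) / q)
     (fun i => x i - lattice_pt R t i / q) eta 50^-1 (ltW eta0).
  have -> : (fun i => (lattice_pt R t i - lattice_pt R c i) / q + (x i - lattice_pt R t i / q)) =
            (fun i => x i - lattice_pt R c i / q).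
    by apply/funext => i; ring.
  apply; [goal_lra|exact: ct|].
  apply: le_trans (sqnorm_image_le _ _) _.
  apply: le_trans (_ : (3 / 4 * K * eta ^+ 2) * (n / q ^+ 2) <= _).
    apply: ler_pM => //; last by apply: sumr_ge0 => i _; exact: sqr_ge0.
    by apply: sumr_ge0 => j _; apply: sumr_ge0 => i _; exact: sqr_ge0.
  move: nq; set y := n / q ^+ 2 => nq.
  have := ler_wpM2l (sqr_ge0 eta) nq; have := sqr_ge0 eta; rewrite exprMn; goal_lra.
Qed.

(** * One half step contracts a cell *)

(** The exponent [2k + 2] is even, so that norms are polynomials. *)
Definition psum (R : realType) (I : finType) (k : nat) (u : I -> R) : R :=
  \sum_i u i ^+ k.*2.+2.

(** Half a step of the power method: for the exponent [2k + 2] the duality map is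
    the odd power [2k + 1]. *)
Definition pstep (R : realType) (I J : finType) (B : J -> I -> R) (k : nat)
  (u : I -> R) (j : J) : R := \sum_i B j i * u i ^+ k.*2.+1.

(** A ball around [c] for the weights [`|c i| ^ k], in which the derivative of
    [pstep] has a small Hilbert-Schmidt norm. The offset [phi] keeps the weights
    away from zero, so that these balls are bounded. *)
Definition near_pt (R : realType) (I : finType) (k : nat) (phi eps : R) (c v : I -> R) :=
  \sum_i ((`|c i| + phi) ^+ k * (v i - c i)) ^+ 2 <= eps ^+ 2.

(** Normalization up to a constant; the slack absorbs the displacement of the new
    centres in [half_step]. *)
Definition unit_like (R : realType) (I : finType) (k : nat) (c : I -> R) :=
  1 <= psum k c <= 41 / 40.

(** An offset too small to spoil the power sums of normalized vectors, whatever
    the dimension. *)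
Definition fine_offset (R : realType) (I : finType) (k : nat) (phi : R) :=
  0 < phi <= 1 /\ forall c : I -> R, psum k c <= 41 / 40 ->
    \sum_i (`|c i| + 2 * phi) ^+ k.*2.+2 <= 21 / 20.

Lemma evenXE (R : realType) (x : R) k : x ^+ k.*2.+2 = (x ^+ 2) ^+ k.+1.
Proof. by rewrite -exprM mul2n doubleS. Qed.

Lemma evenX_ge0 (R : realType) (x : R) k : 0 <= x ^+ k.*2.+2.
Proof. by rewrite evenXE exprn_ge0// sqr_ge0. Qed.

Lemma evenX_norm (R : realType) (x : R) k : `|x| ^+ k.*2.+2 = x ^+ k.*2.+2.
Proof. by rewrite -normrX ger0_norm ?evenX_ge0. Qed.

Lemma psum_ge0 (R : realType) (I : finType) k (u : I -> R) : 0 <= psum k u.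
Proof. by apply: sumr_ge0 => i _; exact: evenX_ge0. Qed.

Lemma psum_coord (R : realType) (I : finType) k (u : I -> R) i : u i ^+ k.*2.+2 <= psum k u.
Proof. by rewrite /psum (bigD1 i)//= lerDl sumr_ge0// => i' _; exact: evenX_ge0. Qed.

Lemma psum_coord_le2 (R : realType) (I : finType) k (u : I -> R) i :
  psum k u <= 41 / 40 -> `|u i| <= 2.
Proof.
move=> u1; rewrite leNgt; apply/negP => h.
have := le_trans (psum_coord k u i) u1; rewrite -evenX_norm.
have : (2 : R) ^+ 1 <= `|u i| ^+ k.*2.+2.
  apply: le_trans (_ : 2 ^+ k.*2.+2 <= _); first by rewrite ler_weXn2l// ler1n.
  by rewrite lerXn2r// ?nnegrE// ltW.
rewrite expr1; lra.
Qed.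

Lemma psum_perturb (R : realType) (I : finType) k (u v : I -> R) (L d : R) :
  (forall i, `|u i| <= L) -> (forall i, `|v i| <= L) -> 0 <= L ->
  (forall i, `|u i - v i| <= d) ->
  `|psum k u - psum k v| <= #|I|%:R * (k.*2.+2%:R * L ^+ k.*2.+1 * d).
Proof.
move=> uL vL L0 uv; rewrite /psum -sumrB.
apply: le_trans (ler_norm_sum _ _ _) _.
rewrite mulr_natl -sumr_const; apply: ler_sum => i _.
apply: le_trans (subX_le _ (uL i) (vL i)) _.
by apply: ler_wpM2l => //; apply: mulr_ge0 => //; exact: exprn_ge0.
Qed.

Lemma pstep_perturb (R : realType) (I J : finType) (B : J -> I -> R) k (u v : I -> R) (L d : R) :
  (forall j i, `|B j i| <= 1) ->
  (forall i, `|u i| <= L) -> (forall i, `|v i| <= L) -> 0 <= L ->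
  (forall i, `|u i - v i| <= d) ->
  forall j, `|pstep B k u j - pstep B k v j| <= #|I|%:R * (k.*2.+1%:R * L ^+ k.*2 * d).
Proof.
move=> B1 uL vL L0 uv j; rewrite /pstep -sumrB.
apply: le_trans (ler_norm_sum _ _ _) _.
rewrite mulr_natl -sumr_const; apply: ler_sum => i _.
rewrite -mulrBr normrM -[leRHS]mul1r; apply: ler_pM => //.
apply: le_trans (subX_le _ (uL i) (vL i)) _.
by apply: ler_wpM2l => //; apply: mulr_ge0 => //; exact: exprn_ge0.
Qed.

(** The power mean inequality between the exponents [2k] and [2k + 2]; the
    exponent is large enough for the cardinality to cost only a factor [e]. *)
Lemma power_mean (R : realType) (I : finType) k (t : I -> R) :
  #|I|%:R <= expR k.+1%:R :> R -> \sum_i t i ^+ k.*2.+2 <= 21 / 20 ->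
  \sum_i t i ^+ k.*2 <= expR 1 * (21 / 20).
Proof.
move=> nk t1.
have e0 := expR_gt0 (- 1 : R).
have h : k.+1%:R * (expR (-1) * \sum_i t i ^+ k.*2) <=
    k%:R * \sum_i t i ^+ k.*2.+2 + #|I|%:R * expR (- 1) ^+ k.+1.
  rewrite mulr_sumr mulr_sumr [in leRHS]mulr_sumr mulr_natl -sumr_const -big_split/=.
  apply: ler_sum => i _; rewrite [expR _ * _]mulrC.
  have -> : t i ^+ k.*2 = (t i ^+ 2) ^+ k by rewrite -exprM mul2n.
  by rewrite evenXE; apply: wAGM; [exact: sqr_ge0|exact: ltW].
have h2 : #|I|%:R * expR (- 1) ^+ k.+1 <= 1 :> R.
  rewrite -expRM_natl mulrN1 expRN ler_pdivrMr ?expR_gt0// mul1r//.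
have k0 : 0 <= k%:R :> R by [].
have : k.+1%:R * (expR (-1) * \sum_i t i ^+ k.*2) <= k.+1%:R * (21 / 20).
  apply: le_trans h _; have := ler_wpM2l k0 t1; rewrite -natr1; lra.
rewrite ler_pM2l// expRN => h3.
by rewrite -ler_pdivrMl ?expR_gt0.
Qed.

Lemma exists_fine_offset (R : realType) (I : finType) k :
  exists phi : R, fine_offset I k phi.
Proof.
pose C : R := 80 * (#|I|.+1%:R * (k.*2.+2%:R * 4 ^+ k.*2.+1)).
have C0 : 1 <= C.
  rewrite /C; have : 1 <= 4 ^+ k.*2.+1 :> R by rewrite exprn_ege1// ler1n.
  have : 1 <= #|I|.+1%:R :> R by rewrite ler1n.
  have : 1 <= k.*2.+2%:R :> R by rewrite ler1n.
  set a : R := #|I|.+1%:R; set b : R := k.*2.+2%:R; set c : R := 4 ^+ _ => ha hb hc.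
  have ac : 1 * 1 <= a * c by apply: ler_pM.
  have : 1 * 1 <= b * (a * c) by apply: ler_pM => //; lra.
  lra.
exists C^-1; split.
  by rewrite invr_gt0 (lt_le_trans _ C0)//= invf_le1// (lt_le_trans _ C0).
move=> c c1.
have V1 : C^-1 <= 1 by rewrite invf_le1// (lt_le_trans _ C0).
have V0 : 0 <= C^-1 by rewrite invr_ge0 (le_trans _ C0).
have := @psum_perturb R I k (fun i => `|c i| + 2 * C^-1) (fun i => `|c i|) 4 (2 * C^-1).
have -> : psum k (fun i => `|c i|) = psum k c.
  by apply: eq_bigr => i _; rewrite evenX_norm.
move=> H; have {}H := H _ _ _ _.
have : `|psum k (fun i => `|c i| + 2 / C) - psum k c| <= 1 / 40.
  apply: le_trans (H _ _ _ _) _.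
  - by move=> i; rewrite ger0_norm ?addr_ge0 ?mulr_ge0//; have := psum_coord_le2 i c1; lra.
  - by move=> i; rewrite normr_id; have := psum_coord_le2 i c1; lra.
  - by [].
  - by move=> i; rewrite addrAC subrr add0r ger0_norm// mulr_ge0.
  have -> : 1 / 40 = (80 * (#|I|.+1%:R * (k.*2.+2%:R * 4 ^+ k.*2.+1))) * C^-1 / 40.
    by rewrite -/C mulfV// gt_eqF// (lt_le_trans _ C0).
  rewrite -(natr1 #|I|).
  set a : R := #|I|%:R; set x : R := _ * 4 ^+ _.
  have : 0 <= x * C^-1 by rewrite !mulr_ge0// exprn_ge0.
  have : 0 <= a * (x * C^-1) by rewrite !mulr_ge0// exprn_ge0.
  lra.
rewrite ler_norml -/(psum k _) => /andP[_]; lra.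
Qed.

(** With [p = 2k + 2] and [q = 2k' + 2] this says that the [q]-norm of [pstep B k u]
    is at least the [p]-norm of [u] to the power [p - 1], raised to the power
    [p q / 2] to have integral exponents. *)
Definition good_state (R : realType) (I J : finType) (B : J -> I -> R) (k k' : nat)
  (u : I -> R) :=
  psum k u ^+ (k.*2.+1 * k'.+1) <= psum k' (pstep B k u) ^+ k.+1.

(** Only [v] is known to be good, but the centre [c] is so close to it that its
    image is nearly as large. *)
Lemma near_image (R : realType) (I J : finType) (B : J -> I -> R) (k k' : nat)
    (phi : R) : (0 < #|I|)%N -> (forall j i, `|B j i| = 1) -> fine_offset I k phi ->
  exists2 eps0 : R, 0 < eps0 & forall eps, 0 < eps <= eps0 ->
    forall c v : I -> R, unit_like k c -> good_state B k k' v ->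
    near_pt k phi eps c v -> 19 / 20 <= psum k' (pstep B k c).
Proof.
move=> I0 B1 [/andP[phi0 phi1] _].
have phik : 0 < phi ^+ k by rewrite exprn_gt0.
pose n : R := #|I|%:R; pose n' : R := #|J|%:R.
pose C1 : R := (phi ^+ k.+1)^-1.
pose C2 : R := 40 * (k.*2.+1 * k'.+1)%:R * (n * (k.*2.+2%:R * 3 ^+ k.*2.+1)) / phi ^+ k.
pose Y : R := n * 3 ^+ k.*2.+1.
pose l1 : R := n * (k.*2.+1%:R * 3 ^+ k.*2) / phi ^+ k.
pose C3 : R := 40 * (n' * (k'.*2.+2%:R * Y ^+ k'.*2.+1)) * l1.
have X0 m : 0 <= (3 : R) ^+ m by rewrite exprn_ge0.
have n0 : 0 <= n by []. have n'0 : 0 <= n' by [].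
have Y0 : 0 <= Y by rewrite mulr_ge0.
have C10 : 0 < C1 by rewrite invr_gt0 exprn_gt0.
have C20 : 0 <= C2 by rewrite divr_ge0 ?(ltW phik)// !mulr_ge0.
have l10 : 0 <= l1 by rewrite divr_ge0 ?(ltW phik)// !mulr_ge0.
have C30 : 0 <= C3 by rewrite mulr_ge0// !mulr_ge0// exprn_ge0.
exists (C1 + C2 + C3)^-1; first by rewrite invr_gt0; lra.
move=> eps /andP[e0 e1] c v /andP[c1 c2] gv ncv.
have Ce C : C <= C1 + C2 + C3 -> C * eps <= 1.
  move=> h; have S0 : 0 < C1 + C2 + C3 by lra.
  apply: le_trans (_ : (C1 + C2 + C3) * eps <= 1); first by rewrite ler_wpM2r// ltW.
  by rewrite -ler_pdivlMl// mulr1.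
have e1' : eps / phi ^+ k <= phi.
  have : C1 * eps <= 1 by apply: Ce; lra.
  by rewrite /C1 ler_pdivrMl ?exprn_gt0// mulr1 ler_pdivrMr// -exprS.
have dl i : `|v i - c i| <= eps / phi ^+ k.
  have : ((`|c i| + phi) ^+ k * (v i - c i)) ^+ 2 <= eps ^+ 2.
    apply: le_trans ncv; rewrite (bigD1 i)//= lerDl sumr_ge0// => j _; exact: sqr_ge0.
  rewrite -[X in X <= _]real_normK ?num_real// ler_sqr ?nnegrE ?(ltW e0)//.
  rewrite normrM ger0_norm ?exprn_ge0 ?addr_ge0 ?(ltW phi0)// => h.
  rewrite ler_pdivlMr// mulrC; apply: le_trans h; rewrite ler_wpM2r//.
  by rewrite lerXn2r// ?nnegrE ?addr_ge0 ?(ltW phi0)// lerDr.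
have cL i : `|c i| <= 3 by have := psum_coord_le2 i c2; lra.
have vL i : `|v i| <= 3.
  have := psum_coord_le2 i c2; have := dl i; have := ler_normD (v i - c i) (c i).
  by rewrite subrK; lra.
have v1 : 1 - ((40 * (k.*2.+1 * k'.+1)%:R)^-1) <= psum k v.
  have := psum_perturb k vL cL (ler0n R 3) dl; rewrite ler_norml => /andP[h _].
  have h2 : C2 * eps <= 1 by apply: Ce; lra.
  have : n * ((k.*2).+2%:R * 3 ^+ (k.*2).+1 * (eps / phi ^+ k)) <= (40 * (k.*2.+1 * k'.+1)%:R)^-1.
    rewrite -[leRHS]mul1r ler_pdivlMr ?mulr_gt0 ?ltr0n//.
    apply: le_trans h2.
    by rewrite /C2 le_eqVlt; apply/orP; left; apply/eqP; ring.
  move: h; rewrite -/n; set a := _ * (_ * _ * _) => h; set b := _^-1 => ab; lra.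
have y1 : 39 / 40 <= psum k' (pstep B k v).
  have t0 : 0 <= (40 * (k.*2.+1 * k'.+1)%:R : R)^-1 <= 1.
    by rewrite -natrM invr_ge0 ler0n/= invf_le1 ?ltr0n ?ler1n ?muln_gt0.
  apply: (@expr_ge_base _ _ _ k); [exact: psum_ge0|lra|].
  apply: le_trans gv; apply: le_trans (_ : (1 - (40 * (k.*2.+1 * k'.+1)%:R)^-1) ^+ (k.*2.+1 * k'.+1) <= _).
    apply: le_trans (bernoulli _ t0).
    rewrite invfM mulrCA mulfV ?pnatr_eq0 ?muln_eq0// mulr1; lra.
  by rewrite lerXn2r ?nnegrE ?psum_ge0// subr_ge0; case/andP: t0.
have B1' j i : `|B j i| <= 1 by rewrite B1.
have yY (u : I -> R) : (forall i, `|u i| <= 3) -> forall j, `|pstep B k u j| <= Y.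
  move=> uL j; apply: le_trans (ler_norm_sum _ _ _) _.
  rewrite /Y mulr_natl -sumr_const; apply: ler_sum => i _.
  by rewrite normrM B1 mul1r normrX lerXn2r ?nnegrE.
have := psum_perturb k' (yY _ vL) (yY _ cL) Y0 (pstep_perturb k B1' vL cL (ler0n R 3) dl).
rewrite ler_norml => /andP[_ h].
have : n' * ((k'.*2).+2%:R * Y ^+ (k'.*2).+1 *
   (n * ((k.*2).+1%:R * 3 ^+ k.*2 * (eps / phi ^+ k)))) <= 1 / 40.
  suff <- : C3 * eps / 40 = n' * ((k'.*2).+2%:R * Y ^+ (k'.*2).+1 *
   (n * ((k.*2).+1%:R * 3 ^+ k.*2 * (eps / phi ^+ k)))).
    have : C3 * eps <= 1 by apply: Ce; lra.
    lra.
  by rewrite /C3 /l1; field; rewrite gt_eqF.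
rewrite -/n' -/n in h; lra.
Qed.

(** One half step multiplies the radius of a cell by [eta] and the number of
    cells by [exp (3 K / 5)]. In the coordinates in which the cells are balls,
    the derivative of the step has Hilbert-Schmidt norm at most about
    [(2 k + 1) e]: the entries of [B] have modulus one, so the squared norm
    splits into a product of two power sums of exponents [2 k] and [2 k'], and
    each is at most about [e] by [power_mean]. *)
Lemma half_step (R : realType) (I J : finType) (B : J -> I -> R) (k k' : nat)
    (phi phi' K eta : R) :
  (0 < #|I|)%N -> (forall j i, `|B j i| = 1) ->
  #|I|%:R <= expR k.+1%:R :> R -> #|J|%:R <= expR k'.+1%:R :> R ->
  500 <= K -> #|I|%:R <= expR (K / 100) ->
  fine_offset I k phi -> fine_offset J k' phi' ->
  0 < eta -> 5 / 3 * (k.*2.+1%:R * expR 1) ^+ 2 <= K * eta ^+ 2 ->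
  exists2 eps0 : R, 0 < eps0 & forall eps, 0 < eps <= eps0 ->
    forall c : I -> R, unit_like k c ->
    exists (T : finType) (c' : T -> J -> R),
    [/\ #|T|%:R <= expR (3 / 5 * K), forall a, unit_like k' (c' a) &
        forall v, good_state B k k' v -> near_pt k phi eps c v ->
        exists a N, 0 < N /\
          near_pt k' phi' (eta * eps) (c' a) (fun j => pstep B k v j / N)].
Proof.
move=> I0 B1 Ik Jk' K5 IK fineI fineJ eta0 etaK.
have [epsA epsA0 HA] := near_image k' I0 B1 fineI.
have [Gam Gam0 cover] := ellipsoid_cover I0 K5 IK.
have [/andP[phi0 phi1] phiS] := fineI.
have [/andP[phi'0 phi'1] phi'S] := fineJ.
have phik : 0 < phi ^+ k by rewrite exprn_gt0.
pose n : R := #|I|%:R; pose n' : R := #|J|%:R.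
have n0 : 0 <= n by []. have n'0 : 0 <= n' by [].
pose P : R := k.*2.+1%:R.
have P0 : 0 < P by rewrite ltr0n.
have X0 m : 0 <= (3 : R) ^+ m by rewrite exprn_ge0.
pose l2 : R := 2 * n * P * 3 ^+ k * Gam.
have l20 : 0 <= l2 by rewrite !mulr_ge0// ltW.
pose C1 : R := (phi ^+ k.+1)^-1.
pose C4 : R := l2 / phi'.
pose C5 : R := 80 * (n' * (k'.*2.+2%:R * 3 ^+ k'.*2.+1)) * l2.
have C10 : 0 < C1 by rewrite invr_gt0 exprn_gt0.
have C40 : 0 <= C4 by rewrite divr_ge0// ltW.
have C50 : 0 <= C5 by rewrite /C5; apply: mulr_ge0 => //; rewrite !mulr_ge0.
have S0 : 0 < C1 + C4 + C5 + epsA^-1.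
  by have : 0 < epsA^-1; [rewrite invr_gt0|move: C10 C40 C50; goal_lra].
exists (C1 + C4 + C5 + epsA^-1)^-1; first by rewrite invr_gt0.
move=> eps /andP[e0 e1] c uc; have /andP[c1 c2] := uc.
have Ce C : C <= C1 + C4 + C5 + epsA^-1 -> C * eps <= 1.
  move=> h; apply: le_trans (_ : (C1 + C4 + C5 + epsA^-1) * eps <= 1).
    by rewrite ler_wpM2r// ltW.
  by rewrite -ler_pdivlMl// mulr1.
have V0 : 0 < epsA^-1 by rewrite invr_gt0.
have eA : 0 < eps <= epsA.
  rewrite e0/=; have : epsA^-1 * eps <= 1 by apply: Ce; move: C10 C40 C50; goal_lra.
  by rewrite ler_pdivrMl// mulr1.
have e1' : eps / phi ^+ k <= phi.
  have : C1 * eps <= 1 by apply: Ce; move: V0 C40 C50; goal_lra.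
  by rewrite /C1 ler_pdivrMl ?exprn_gt0// mulr1 ler_pdivrMr// -exprS.
have h4 : l2 * eps <= phi'.
  have : C4 * eps <= 1 by apply: Ce; move: V0 C10 C50; goal_lra.
  by rewrite /C4 mulrAC ler_pdivrMr// mul1r.
have h5 : n' * (k'.*2.+2%:R * 3 ^+ k'.*2.+1 * (l2 * eps)) <= 1 / 80.
  have : C5 * eps <= 1 by apply: Ce; move: V0 C10 C40; goal_lra.
  by rewrite /C5; goal_lra.
(* A cell without good points needs no image. *)
have [[v0 [gv0 nv0]]|none] := pselect (exists v, good_state B k k' v /\ near_pt k phi eps c v);
    last first.
  exists 'I_0, (fun _ _ => 0); split=> [|[]//|v gv nv]; first by rewrite card_ord expR_ge0.
  by case: none; exists v.
(* Normalize the image of the centre to [81 / 80], the middle of the interval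
   allowed by [unit_like]: the new centres are close to it. *)
pose yc := pstep B k c.
have big : 19 / 20 <= psum k' yc := HA eps eA c v0 uc gv0 nv0.
have Syc : 0 < psum k' yc / (81 / 80) by move: big; goal_lra.
have [N N0 NE] := @exists_root R _ k'.*2.+1 Syc.
have N2 : 76 / 81 <= N ^+ 2.
  apply: (@expr_ge_base _ _ _ k'); [exact: sqr_ge0|goal_lra|].
  by rewrite -evenXE NE; move: big; goal_lra.
have N12 : N^-1 <= 2.
  rewrite -(ler_pM2l N0) mulfV ?gt_eqF//; move: N0 N2 => {}N0 {}N2.
  by rewrite leNgt; apply/negP => Nlt; move: N0 N2 Nlt; clear; nra.
pose vc j := yc j / N.
have Svc : psum k' vc = 81 / 80.
  rewrite /psum; under eq_bigr do rewrite expr_div_n.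
  rewrite -mulr_suml -/(psum k' yc) NE; have S0' : psum k' yc != 0.
    by rewrite gt_eqF//; move: big; goal_lra.
  by field.
pose w i := (`|c i| + phi) ^+ k.
have w0 i : 0 < w i by rewrite exprn_gt0// ltr_wpDl.
(* Up to scaling, the image of the cell is the image of the unit ball under
   [D]; in the weights of the new cells, it becomes the image under [E]. *)
pose D j i := P * eps * w i * B j i / N.
pose E j i := (`|vc j| + 2 * phi') ^+ k' * D j i.
have Evc0 j : 0 <= `|vc j| + 2 * phi' by rewrite addr_ge0// mulr_ge0// ltW.
have HS : \sum_j \sum_i E j i ^+ 2 <= 3 / 4 * K * (eta * eps) ^+ 2.
  have -> : \sum_j \sum_i E j i ^+ 2 = (P * eps) ^+ 2 / N ^+ 2 *
     ((\sum_i (`|c i| + phi) ^+ k.*2) * \sum_j (`|vc j| + 2 * phi') ^+ k'.*2).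
    rewrite mulrC big_distrlr/= [RHS]mulr_suml exchange_big/=.
    apply: eq_bigr => i _; rewrite mulr_suml; apply: eq_bigr => j _.
    rewrite /E /D /w !exprMn -!exprM !muln2 -[B j i ^+ 2]real_normK ?num_real// B1 expr1n.
    by rewrite exprVn; ring.
  have p1 : \sum_i (`|c i| + phi) ^+ k.*2 <= expR 1 * (21 / 20).
    apply: power_mean => //; apply: le_trans (phiS _ c2).
    apply: ler_sum => i _; rewrite lerXn2r ?nnegrE ?addr_ge0 ?mulr_ge0 ?(ltW phi0)//.
    by rewrite lerD2l; move: phi0; goal_lra.
  have p2 : \sum_j (`|vc j| + 2 * phi') ^+ k'.*2 <= expR 1 * (21 / 20).
    by apply: power_mean => //; apply: phi'S; rewrite Svc; goal_lra.
  have i2 : (P * eps) ^+ 2 / N ^+ 2 <= (P * eps) ^+ 2 * (81 / 76).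
    apply: ler_wpM2l; first exact: sqr_ge0.
    have -> : 81 / 76 = (76 / 81)^-1 :> R by rewrite invf_div.
    by rewrite lef_pV2 ?posrE ?exprn_gt0//; goal_lra.
  apply: le_trans (_ : (P * eps) ^+ 2 * (81 / 76) * ((expR 1 * (21 / 20)) * (expR 1 * (21 / 20))) <= _).
    apply: ler_pM => //.
    - by rewrite divr_ge0 ?sqr_ge0.
    - by apply: mulr_ge0; apply: sumr_ge0 => i _; rewrite exprn_ge0// addr_ge0// ltW.
    - apply: ler_pM => //; apply: sumr_ge0 => i _; rewrite exprn_ge0// addr_ge0// ltW//.
  have := ler_wpM2r (sqr_ge0 eps) etaK; rewrite -/P !exprMn.
  have : 0 <= P ^+ 2 * (expR 1) ^+ 2 * eps ^+ 2 by rewrite -!exprMn sqr_ge0.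
  goal_lra.
have etae : 0 < eta * eps by rewrite mulr_gt0.
have [T [g [cardT gG gE]]] := cover J E (eta * eps) etae HS.
pose c' a j := vc j + \sum_i D j i * g a i.
have cc i : `|c i| + phi <= 3 by have := psum_coord_le2 i c2; move: phi1; goal_lra.
have vc2 j : `|vc j| <= 2 by apply: (@psum_coord_le2 _ _ k'); rewrite Svc; goal_lra.
have dc' a j : `|c' a j - vc j| <= l2 * eps.
  rewrite /c' addrAC subrr add0r; apply: le_trans (ler_norm_sum _ _ _) _.
  have -> : l2 * eps = n * (P * eps * 3 ^+ k * 2 * Gam) by rewrite /l2; ring.
  rewrite /n mulr_natl -sumr_const; apply: ler_sum => i _.
  rewrite normrM; apply: ler_pM => //.
  rewrite !normrM B1 mulr1 (gtr0_norm P0) (gtr0_norm e0) (gtr0_norm (w0 i)).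
  rewrite normfV (gtr0_norm N0); apply: ler_pM => //.
  - by rewrite !mulr_ge0// ltW.
  - by rewrite invr_ge0 ltW.
  - by rewrite ler_pM2l ?mulr_gt0// lerXn2r ?nnegrE ?addr_ge0 ?(ltW phi0).
exists T, c'; split=> // [a|v gv nv].
  have := @psum_perturb R J k' (c' a) vc 3 (l2 * eps) _ _ (ler0n R 3) (dc' a).
  rewrite Svc => h; have : `|psum k' (c' a) - 81 / 80| <= 1 / 80.
    apply: le_trans (h _ _) _ => // j; last by have := vc2 j; goal_lra.
    have := ler_normD (c' a j - vc j) (vc j); rewrite subrK.
    by have := dc' a j; have := vc2 j; move: h4 phi'1; goal_lra.
  by rewrite ler_norml => /andP[h1 h2]; apply/andP; split; move: h1 h2; goal_lra.
(* The displacement of the odd powers is not linear in [v - c], but it is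
   dominated coordinatewise by the linear one, hence [z] is in the unit ball. *)
pose x i := v i ^+ k.*2.+1 - c i ^+ k.*2.+1.
pose z i := x i / (P * eps * w i).
have den i : 0 < P * eps * w i by rewrite !mulr_gt0.
have wd i : (w i * (v i - c i)) ^+ 2 <= eps ^+ 2.
  apply: le_trans nv; rewrite (bigD1 i)//= lerDl sumr_ge0// => j _; exact: sqr_ge0.
have dl i : `|v i - c i| <= phi.
  apply: le_trans e1'; have := wd i.
  rewrite -[X in X <= _]real_normK ?num_real// ler_sqr ?nnegrE ?(ltW e0)//.
  rewrite normrM (gtr0_norm (w0 i)) => h.
  rewrite ler_pdivlMr// mulrC; apply: le_trans h; rewrite ler_wpM2r//.
  by rewrite lerXn2r// ?nnegrE ?addr_ge0 ?(ltW phi0)// lerDr.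
have z1 : \sum_i z i ^+ 2 <= 1.
  rewrite -(ler_pM2r (_ : 0 < eps ^+ 2)) ?exprn_gt0// mul1r; apply: le_trans nv.
  rewrite mulr_suml; apply: ler_sum => i _; rewrite -exprMn -/(w i).
  rewrite -[X in X <= _]real_normK ?num_real// -[X in _ <= X]real_normK ?num_real//.
  rewrite lerXn2r ?nnegrE// !normrM normfV (gtr0_norm (den i)) (gtr0_norm e0) (gtr0_norm (w0 i)).
  rewrite mulrAC ler_pdivrMr//.
  have xi : `|x i| <= P * (w i * w i) * `|v i - c i|.
    have := @subX_le R (`|c i| + phi) (v i) (c i) k.*2.
    have -> : w i * w i = (`|c i| + phi) ^+ k.*2 by rewrite /w -expr2 -exprM muln2.
    apply; last by rewrite lerDl ltW.
    by have := ler_normD (v i - c i) (c i); rewrite subrK; have := dl i; goal_lra.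
  by have := ler_wpM2r (ltW e0) xi; goal_lra.
have [a ha] := gE z z1.
exists a, N; split=> //; apply: le_trans ha; apply: ler_sum => j _.
have -> : pstep B k v j / N - c' a j = \sum_i D j i * (z i - g a i).
  under eq_bigr do rewrite mulrBr.
  rewrite sumrB /c' opprD addrA; congr (_ - _).
  rewrite /vc /yc /pstep -mulrBl -sumrB mulr_suml; apply: eq_bigr => i _.
  by rewrite /D /z /x; field; rewrite !gt_eqF.
have -> : \sum_i E j i * (z i - g a i) =
   (`|vc j| + 2 * phi') ^+ k' * \sum_i D j i * (z i - g a i).
  by rewrite mulr_sumr; apply: eq_bigr => i _; rewrite mulrA.
rewrite !exprMn ler_wpM2r ?sqr_ge0// lerXn2r ?nnegrE ?exprn_ge0// ?addr_ge0 ?(ltW phi'0)//.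
rewrite lerXn2r ?nnegrE// ?addr_ge0 ?(ltW phi'0)//.
have := ler_normD (c' a j - vc j) (vc j); rewrite subrK.
by have := dc' a j; move: h4; goal_lra.
Qed.

(** * Iterating the full step *)

Lemma psumZ (R : realType) (I : finType) k (u : I -> R) s :
  psum k (fun i => s * u i) = s ^+ k.*2.+2 * psum k u.
Proof. by rewrite /psum mulr_sumr; apply: eq_bigr => i _; rewrite exprMn. Qed.

Lemma pstepZ (R : realType) (I J : finType) (B : J -> I -> R) k (u : I -> R) s :
  pstep B k (fun i => s * u i) = (fun j => s ^+ k.*2.+1 * pstep B k u j).
Proof.
apply/funext => j; rewrite /pstep mulr_sumr; apply: eq_bigr => i _.
by rewrite exprMn mulrCA.
Qed.

Lemma good_stateZ (R : realType) (I J : finType) (B : J -> I -> R) k k' (u : I -> R) s :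
  0 < s -> good_state B k k' u -> good_state B k k' (fun i => s * u i).
Proof.
move=> s0; rewrite /good_state pstepZ !psumZ.
rewrite [(s ^+ _ * psum k u) ^+ _]exprMn [(_ * psum k' _) ^+ _]exprMn -!exprM.
have -> : (k.*2.+2 * (k.*2.+1 * k'.+1) = k.*2.+1 * k'.*2.+2 * k.+1)%N.
  by rewrite -!doubleS -!muln2; ring.
by rewrite ler_pM2l// exprn_gt0.
Qed.

(** Hoelder's inequality for the exponent [2 k + 2], from [wAGM] after scaling [w]
    to the norm of [u]. *)
Lemma even_hoelder (R : realType) (I : finType) k (w u : I -> R) :
  0 <= \sum_i w i * u i ^+ k.*2.+1 ->
  (\sum_i w i * u i ^+ k.*2.+1) ^+ k.*2.+2 <= psum k w * psum k u ^+ k.*2.+1.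
Proof.
set S := \sum_i _ => S0.
have [Su0|Su0] := eqVneq (psum k u) 0.
  have u0 i : u i = 0.
    have := psum_coord k u i; rewrite Su0 => h.
    have : u i ^+ k.*2.+2 == 0 by rewrite eq_le h evenX_ge0.
    by rewrite expf_eq0 => /andP[_ /eqP].
  suff -> : S = 0 by rewrite expr0n mulr_ge0 ?psum_ge0// exprn_ge0 ?psum_ge0.
  by apply: big1 => i _; rewrite u0 expr0n mulr0.
have [Sw0|Sw0] := eqVneq (psum k w) 0.
  have w0 i : w i = 0.
    have := psum_coord k w i; rewrite Sw0 => h.
    have : w i ^+ k.*2.+2 == 0 by rewrite eq_le h evenX_ge0.
    by rewrite expf_eq0 => /andP[_ /eqP].
  suff -> : S = 0 by rewrite expr0n mulr_ge0 ?psum_ge0// exprn_ge0 ?psum_ge0.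
  by apply: big1 => i _; rewrite w0 mul0r.
have Su : 0 < psum k u by rewrite lt_def Su0 psum_ge0.
have Sw : 0 < psum k w by rewrite lt_def Sw0 psum_ge0.
have [l l0 lE] := exists_root k.*2.+1 (divr_gt0 Su Sw).
have H : l * S <= psum k u.
  rewrite -(ler_pM2l (_ : 0 < k.*2.+2%:R :> R))//.
  have -> : k.*2.+2%:R * psum k u = k.*2.+1%:R * psum k u + l ^+ k.*2.+2 * psum k w.
    by rewrite lE divfK// -natr1 mulrDl mul1r.
  rewrite /S /psum !mulr_sumr -big_split/=; apply: ler_sum => i _.
  apply: le_trans (_ : k.*2.+2%:R * (`|u i| ^+ k.*2.+1 * (l * `|w i|)) <= _).
    rewrite ler_pM2l// [leRHS]mulrCA ler_pM2l// mulrC.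
    by apply: le_trans (ler_norm _) _; rewrite normrM normrX.
  rewrite -evenX_norm -(evenX_norm (w i)) -exprMn; apply: wAGM => //.
  by rewrite mulr_ge0// ltW.
have lS0 : 0 <= l * S by rewrite mulr_ge0// ltW.
have : (l * S) ^+ k.*2.+2 <= psum k u ^+ k.*2.+2 by rewrite lerXn2r ?nnegrE ?psum_ge0.
rewrite exprMn lE mulrAC ler_pdivrMr// [X in _ <= X * _]exprS -mulrA ler_pM2l//.
by rewrite mulrC.
Qed.

(** The ratio of the norms of the two sides does not decrease along the
    iteration, as in the power method: pair the second step with the first. *)
Lemma good_next (R : realType) (I J : finType) (B : J -> I -> R) k k' (u : I -> R) :
  good_state B k k' u -> 0 < psum k u ->
  good_state (fun i j => B j i) k' k (pstep B k u) /\ 0 < psum k' (pstep B k u).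
Proof.
move=> gu Su; set y := pstep B k u.
have Sy : 0 < psum k' y.
  rewrite lt_def psum_ge0 andbT; apply/eqP => h.
  have := lt_le_trans (exprn_gt0 (k.*2.+1 * k'.+1) Su) gu.
  by rewrite -/y h exprS mul0r ltxx.
split=> //; rewrite /good_state; set u2 := pstep _ _ y.
have SE : \sum_i u2 i * u i ^+ k.*2.+1 = psum k' y.
  rewrite /u2 /pstep /psum; under eq_bigr do rewrite mulr_suml.
  rewrite exchange_big/=; apply: eq_bigr => j _.
  rewrite [RHS]exprSr /y /pstep mulr_sumr; apply: eq_bigr => i _; ring.
have := @even_hoelder R I k u2 u; rewrite SE => /(_ (ltW Sy)) h.
have : (psum k' y ^+ k.*2.+2) ^+ k'.+1 <= (psum k u2 * psum k u ^+ k.*2.+1) ^+ k'.+1.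
  apply: lerXn2r h; rewrite nnegrE; first by apply: exprn_ge0; exact: psum_ge0.
  by apply: mulr_ge0; [|apply: exprn_ge0]; exact: psum_ge0.
rewrite (exprMn _ (psum k u2)) -!exprM => h2.
have : psum k' y ^+ (k.*2.+2 * k'.+1) <= psum k u2 ^+ k'.+1 * psum k' y ^+ k.+1.
  by apply: le_trans h2 _; rewrite ler_wpM2l// exprn_ge0 ?psum_ge0.
have -> : (k.*2.+2 * k'.+1 = k'.*2.+1 * k.+1 + k.+1)%N by rewrite -doubleS -!muln2; ring.
by rewrite exprD ler_pM2r// exprn_gt0.
Qed.

(** Cells are cones: the maps are homogeneous, and only the zeros matter. *)
Definition in_cell (R : realType) (I : finType) k (phi eps : R) (c u : I -> R) :=
  exists2 s, 0 < s & near_pt k phi eps c (fun i => s * u i).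

Definition covered (R : realType) (I : finType) k (phi : R) (P : (I -> R) -> Prop)
    (X eps : R) :=
  exists (T : finType) (c : T -> I -> R),
  [/\ #|T|%:R <= X, forall a, unit_like k (c a) &
      forall u, P u -> exists a, in_cell k phi eps (c a) u].

Lemma covered_image (R : realType) (I J : finType) (B : J -> I -> R) (k k' : nat)
    (phi phi' K eta eps X : R) (P : (I -> R) -> Prop) :
  (forall c : I -> R, unit_like k c ->
    exists (T : finType) (c' : T -> J -> R),
    [/\ #|T|%:R <= expR (3 / 5 * K), forall a, unit_like k' (c' a) &
        forall v, good_state B k k' v -> near_pt k phi eps c v ->
        exists a N, 0 < N /\
          near_pt k' phi' (eta * eps) (c' a) (fun j => pstep B k v j / N)]) ->
  (forall u, P u -> good_state B k k' u) ->
  covered k phi P X eps ->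
  covered k' phi' (fun y => exists2 u, P u & y = pstep B k u)
    (X * expR (3 / 5 * K)) (eta * eps).
Proof.
move=> H Pgood [T [c [TX uc Pc]]].
have {}H a := H _ (uc a).
have [T' HT'] := choice H.
pose c' a := projT1 (cid (HT' a)); have Hc' a := projT2 (cid (HT' a)).
exists {: {a : T & T' a}}, (fun b => c' (tag b) (tagged b)); split.
- rewrite card_tagged sumnE big_map big_enum/= natr_sum.
  apply: le_trans (_ : \sum_(a : T) expR (3 / 5 * K) <= _).
    by apply: ler_sum => a _; have [] := Hc' a.
  by rewrite sumr_const -(mulr_natl (expR _) #|T|) ler_wpM2r ?expR_ge0.
- by move=> [a b]; have [_ +  _] := Hc' a; exact.
move=> _ [u Pu ->]; have [a [s s0 near_su]] := Pc u Pu.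
have [_ _ /(_ _ (good_stateZ s0 (Pgood u Pu)) near_su)] := Hc' a.
rewrite pstepZ => -[b [N [N0 hN]]].
exists (Tagged T' b), (s ^+ k.*2.+1 / N); first by rewrite divr_gt0 ?exprn_gt0.
apply: le_trans hN; rewrite le_eqVlt; apply/orP; left; apply/eqP.
by apply: eq_bigr => j _; rewrite [s ^+ _ / N * _]mulrAC.
Qed.

Definition full_step (R : realType) (I J : finType) (B : J -> I -> R) (k k' : nat)
    (u : I -> R) : I -> R :=
  pstep (fun i j => B j i) k' (pstep B k u).

Definition regular_state (R : realType) (I J : finType) (B : J -> I -> R) (k k' : nat)
    (u : I -> R) := good_state B k k' u /\ 0 < psum k u.

Lemma regular_full_step (R : realType) (I J : finType) (B : J -> I -> R) (k k' : nat) u :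
  regular_state B k k' u -> regular_state B k k' (full_step B k k' u).
Proof.
by move=> [gu Su]; have [gy Sy] := good_next gu Su; have [gz Sz] := good_next gy Sy.
Qed.

Lemma covered_iter (R : realType) (I J : finType) (B : J -> I -> R) (k k' : nat)
    (phi phi' K eta eta' : R) :
  (0 < #|I|)%N -> (0 < #|J|)%N -> (forall j i, `|B j i| = 1) ->
  #|I|%:R <= expR k.+1%:R :> R -> #|J|%:R <= expR k'.+1%:R :> R ->
  500 <= K -> #|I|%:R <= expR (K / 100) -> #|J|%:R <= expR (K / 100) ->
  fine_offset I k phi -> fine_offset J k' phi' ->
  0 < eta -> 5 / 3 * (k.*2.+1%:R * expR 1) ^+ 2 <= K * eta ^+ 2 ->
  0 < eta' -> 5 / 3 * (k'.*2.+1%:R * expR 1) ^+ 2 <= K * eta' ^+ 2 ->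
  eta' * eta <= 1 ->
  exists2 eps0 : R, 0 < eps0 & forall eps X (P : (I -> R) -> Prop), 0 < eps <= eps0 ->
    (forall u, P u -> regular_state B k k' u) ->
    covered k phi P X eps ->
    forall m, covered k phi (fun w => exists2 u, P u & w = iter m (full_step B k k') u)
      (X * expR (6 / 5 * K) ^+ m) ((eta' * eta) ^+ m * eps).
Proof.
move=> I0 J0 B1 Ik Jk K5 IK JK fI fJ e0 eK e'0 e'K ee'.
have [E1 E10 H1] := half_step I0 B1 Ik Jk K5 IK fI fJ e0 eK.
have B1' i j : `|B j i| = 1 by [].
have [E2 E20 H2] := half_step J0 B1' Jk Ik K5 JK fJ fI e'0 e'K.
exists (Num.min E1 (E2 / eta)); first by rewrite lt_min E10 divr_gt0.
move=> eps X P /andP[eps0]; rewrite le_min => /andP[epsE1 epsE2] Preg cov0.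
have regm m u : P u -> regular_state B k k' (iter m (full_step B k k') u).
  by move=> Pu; elim: m => [|m IH]; [exact: Preg|exact: regular_full_step].
elim=> [|m IH].
  rewrite !expr0 mulr1 mul1r; have [T [c [TX uc Pc]]] := cov0.
  by exists T, c; split=> // _ [u Pu ->]; exact: Pc.
have t0 : 0 < (eta' * eta) ^+ m by rewrite exprn_gt0// mulr_gt0.
have t1 : (eta' * eta) ^+ m <= 1 by rewrite exprn_ile1// mulr_ge0// ltW.
have em0 : 0 < (eta' * eta) ^+ m * eps by rewrite mulr_gt0.
have em1 : (eta' * eta) ^+ m * eps <= eps by rewrite ler_piMl// ltW.
have half1 : 0 < (eta' * eta) ^+ m * eps <= E1 by rewrite em0 (le_trans em1).
have half2 : 0 < eta * ((eta' * eta) ^+ m * eps) <= E2.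
  by rewrite mulr_gt0//= mulrC -ler_pdivlMr// (le_trans em1).
have c1 := covered_image (H1 _ half1) (_ : forall w, _ -> good_state B k k' w) IH.
have {}c1 : covered k' phi' (fun y => exists2 w,
      (exists2 u, P u & w = iter m (full_step B k k') u) & y = pstep B k w)
    (X * expR (6 / 5 * K) ^+ m * expR (3 / 5 * K)) (eta * ((eta' * eta) ^+ m * eps)).
  by apply: c1 => _ [u Pu ->]; have [] := regm m u Pu.
have c2 := covered_image (H2 _ half2) (_ : forall w, _ -> good_state _ k' k w) c1.
have {}c2 : covered k phi (fun z => exists2 y, (exists2 w,
      (exists2 u, P u & w = iter m (full_step B k k') u) & y = pstep B k w) &
       z = pstep (fun i j => B j i) k' y)
    (X * expR (6 / 5 * K) ^+ m * expR (3 / 5 * K) * expR (3 / 5 * K))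
    (eta' * (eta * ((eta' * eta) ^+ m * eps))).
  apply: c2 => _ [_ [u Pu ->] ->]; have [g S] := regm m u Pu.
  by have [] := good_next g S.
have [T [c [TX uc Pc]]] := c2; exists T, c; split=> //.
- apply: le_trans TX _; rewrite le_eqVlt; apply/orP; left; apply/eqP.
  rewrite exprSr -!mulrA -expRD; congr (_ * (_ * expR _)); lra.
- move=> _ [u Pu ->]; have [|a ca] := Pc (iter m.+1 (full_step B k k') u).
    exists (pstep B k (iter m (full_step B k k') u)) => //.
    by exists (iter m (full_step B k k') u) => //; exists u.
  by exists a; rewrite exprS -!mulrA.
Qed.

(** * A linear map that avoids all cells *)

Lemma eq_mod_close (a b h : nat) : (a = b %[mod h])%N -> (a < b + h)%N -> (b < a + h)%N -> a = b.
Proof.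
wlog ab : a b / (a <= b)%N.
  move=> H e l1 l2; case: (leqP a b) => [ab|/ltnW ba]; first exact: H.
  by symmetry; apply: H.
move=> e _ l2; have : (h %| b - a)%N by rewrite -eqn_mod_dvd// e.
have bah : (b - a < h)%N by rewrite ltn_subLR.
have [|/dvdn_leq h2 /h2] := posnP (b - a)%N; last by rewrite leqNgt bah.
by move=> /eqP; rewrite subn_eq0 => ba _; apply/eqP; rewrite eqn_leq ab.
Qed.

(** On a line in the direction [i0], where [x] is large, the points of a slab are
    so close together that their residue modulo [h] determines them. *)
Lemma slab_count (R : realType) (I : finType) (Q h : nat) (x : I -> R) (i0 : I) (l : R) :
  (0 < h)%N -> 2 * l < h%:R * `|x i0| ->
  (#|[set g : {ffun I -> 'I_Q} | (`|\sum_i (g i)%:R * x i| <= l)%R]| * Q <= h * Q ^ #|I|)%N.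
Proof.
move=> h0 lh; set Bad := finset _.
pose put (g : {ffun I -> 'I_Q}) (t : 'I_Q) := [ffun i => if i == i0 then t else g i].
pose F (z : {ffun I -> 'I_Q} * 'I_Q) : 'I_h * {ffun I -> 'I_Q} :=
  (Ordinal (ltn_pmod (z.1 i0) h0), put z.1 z.2).
have -> : (h * Q ^ #|I| = #|{: 'I_h * {ffun I -> 'I_Q}}|)%N.
  by rewrite card_prod card_ffun !card_ord.
have -> : (#|Bad| * Q = #|finset.setX Bad [set: 'I_Q]%SET|)%N.
  by rewrite cardsX cardsT card_ord.
rewrite -(card_in_imset (f := F)) ?max_card//.
move=> [g t] [g' t']; rewrite !inE/= !andbT => gB gB' [] emod /ffunP eput.
have tt' : t = t' by have := eput i0; rewrite !ffunE eqxx.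
have off i : i != i0 -> g i = g' i.
  by move=> ii0; have := eput i; rewrite !ffunE (negbTE ii0).
suff e0 : g i0 = g' i0.
  by congr pair => //; apply/ffunP => i; have [->|/off] := eqVneq i i0.
have close : `|(g i0)%:R - (g' i0)%:R| < h%:R :> R.
  have x0 : 0 < `|x i0|.
    rewrite normr_gt0; apply/eqP => x0; move: lh; rewrite x0 normr0 mulr0.
    by have := le_trans (normr_ge0 _) gB; lra.
  rewrite -(ltr_pM2r x0) -normrM; apply: le_lt_trans lh.
  have -> : ((g i0)%:R - (g' i0)%:R) * x i0 =
     \sum_i (g i)%:R * x i - \sum_i (g' i)%:R * x i.
    rewrite -sumrB (bigD1 i0)//= big1 ?addr0 ?mulrBl// => i ii0.
    by rewrite (off i ii0) subrr.
  by have := ler_normB (\sum_i (g i)%:R * x i) (\sum_i (g' i)%:R * x i); lra.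
apply: val_inj => /=; apply: (eq_mod_close emod); rewrite -(ltr_nat R) natrD;
  by move: close; rewrite ltr_norml => /andP[]; lra.
Qed.

(** The final union bound: a cell of radius [eps] contains a zero of a random
    linear map to the [Kn]-dimensional space with probability
    [O(eps ^ Kn)]. The map is drawn from a finite grid of mesh [eps]. *)
Lemma nonvanishing_map (R : realType) (I : finType) (k : nat) (phi : R) :
  (0 < #|I|)%N -> fine_offset I k phi ->
  exists2 C : R, 0 < C & forall (Kn : nat) (eps : R), 0 < eps <= phi ^+ k.+1 ->
    forall (T : finType) (c : T -> I -> R), (forall a, unit_like k (c a)) ->
    #|T|%:R * (C * eps) ^+ Kn < 1 ->
    exists G : 'I_Kn -> I -> R, forall a u, in_cell k phi eps (c a) u ->
      exists b, \sum_i G b i * u i ^+ k.*2.+1 != 0.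
Proof.
move=> I0 [/andP[phi0 phi1] _]; set n : R := #|I|%:R.
have n1 : 1 <= n by rewrite ler1n.
have phik : 0 < phi ^+ k by rewrite exprn_gt0.
pose C1 : R := k.*2.+1%:R * 3 ^+ k.*2 / phi ^+ k.
have C10 : 0 < C1 by rewrite divr_gt0// mulr_gt0// exprn_gt0.
have n0 : 0 < n by exact: lt_le_trans n1.
have nC : 0 < 4 * n ^+ 2 * C1 by apply: mulr_gt0 => //; apply: mulr_gt0 => //; exact: exprn_gt0.
exists (4 * n ^+ 2 * C1 + 1); first by lra.
set C := _ + 1; move=> Kn eps /andP[e0 ephi] T c uc small.
pose Q := (Num.truncn eps^-1).+1.
have Qe : eps^-1 < Q%:R by rewrite truncnS_gt.
have Q0 : 0 < Q%:R :> R by rewrite ltr0n.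
have eQ : 1 <= eps * Q%:R by rewrite -ler_pdivrMl// mulr1 ltW.
pose l : R := Q%:R * (n * (C1 * eps)).
have l0 : 0 < l by apply: mulr_gt0 => //; apply: mulr_gt0 => //; apply: mulr_gt0.
pose h := (Num.truncn (4 * n * l)).+1.
have nl0 : 0 <= 4 * n * l by rewrite ltW// mulr_gt0// mulr_gt0.
have lh : 4 * n * l < h%:R by rewrite truncnS_gt.
have hle : h%:R <= 4 * n * l + 1 by rewrite /h -[X in X <= _]natr1 lerD2r truncn_le.
pose x a i := c a i ^+ k.*2.+1.
pose Bad a := [set g : {ffun I -> 'I_Q} | (`|\sum_i (g i)%:R * x a i| <= l)%R]%SET.
have Badcard a : #|Bad a|%:R <= (C * eps) * (Q%:R ^+ #|I|) :> R.
  have /andP[ca1 ca2] := uc a.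
  (* A normalized vector has a coordinate that is not too small. *)
have [i0 ci0] : exists i0, n^-1 <= c a i0 ^+ k.*2.+2.
    apply: contrapT => /forallNP none; have : psum k (c a) < \sum_(i : I) n^-1.
      have /card_gt0P[j _] := I0.
      apply: ltr_sum => [|i _]; first by apply/hasP; exists j; rewrite ?mem_index_enum.
      by rewrite ltNge; apply/negP/none.
    rewrite sumr_const -mulr_natl mulfV ?gt_eqF//; lra.
  have xi0 : (2 * n)^-1 <= `|x a i0|.
    rewrite -evenX_norm exprSr -normrX in ci0.
    have h2 := psum_coord_le2 i0 ca2.
    rewrite invfM ler_pdivrMl// mulrC; apply: le_trans ci0 _.
    by rewrite ler_wpM2l.
  have cnt : (#|Bad a| * Q <= h * Q ^ #|I|)%N.
    apply: (@slab_count R I Q h (x a) i0 l) => //.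
    apply: lt_le_trans (_ : h%:R * (2 * n)^-1 <= _); last by rewrite ler_wpM2l.
    rewrite ltr_pdivlMr ?mulr_gt0//; apply: le_lt_trans lh.
    by rewrite le_eqVlt; apply/orP; left; apply/eqP; ring.
  rewrite -(ler_pM2r Q0) -natrM; apply: le_trans (_ : (h * Q ^ #|I|)%:R <= _).
    by rewrite ler_nat.
  rewrite natrM natrX mulrAC ler_wpM2r ?exprn_ge0//.
  apply: le_trans hle _.
  have -> : C * eps * Q%:R = 4 * n * l + eps * Q%:R by rewrite /C /l; ring.
  by rewrite lerD2l.
pose FT := {ffun 'I_Kn -> {ffun I -> 'I_Q}}.
have [G HG] : exists G : FT, forall a, G \notin ffun_on (Bad a).
  apply: contrapT => /forallNP none.
  have : #|FT|%:R <= \sum_a #|ffun_on_mem 'I_Kn (mem (Bad a))|%:R :> R.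
    rewrite -sum1_card natr_sum; under [leRHS]eq_bigr do rewrite -sum1_card natr_sum.
    rewrite (exchange_big_dep xpredT)//=; apply: ler_sum => G _.
    have [a] : exists a, G \in ffun_on (Bad a).
      by apply: contrapT => /forallNP hG; apply: (none G) => a; apply/negP.
    by move=> Ga; rewrite (bigD1 a)//= lerDl sumr_ge0.
  rewrite card_ffun card_ffun card_ord card_ord !natrX.
  have lower : \sum_a #|ffun_on_mem 'I_Kn (mem (Bad a))|%:R <=
      #|T|%:R * (C * eps) ^+ Kn * (Q%:R ^+ #|I|) ^+ Kn :> R.
    rewrite -mulrA mulr_natl -sumr_const; apply: ler_sum => a _.
    rewrite card_ffun_on card_ord natrX -exprMn lerXn2r ?nnegrE//.
    by rewrite mulr_ge0 ?exprn_ge0// mulr_ge0 ?ltW//; rewrite /C; lra.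
  move=> /le_trans/(_ lower).
  have FT0 : 0 < (Q%:R ^+ #|I|) ^+ Kn :> R by rewrite exprn_gt0// exprn_gt0.
  by rewrite -[X in X <= _]mul1r ler_pM2r// leNgt small.
exists (fun b i => (G b i)%:R) => a u [s s0 ncell].
have [b Gb] : exists b, G b \notin Bad a.
  apply: contrapT => /forallNP none; have := HG a; apply/negP; rewrite negbK.
  by apply/ffun_onP => b; apply: contrapT => /negP /none.
exists b; apply/eqP => zero.
have /andP[ca1 ca2] := uc a.
have dl i : `|s * u i - c a i| <= eps / phi ^+ k.
  have : ((`|c a i| + phi) ^+ k * (s * u i - c a i)) ^+ 2 <= eps ^+ 2.
    apply: le_trans ncell; rewrite (bigD1 i)//= lerDl sumr_ge0// => j _; exact: sqr_ge0.
  rewrite -[X in X <= _]real_normK ?num_real// ler_sqr ?nnegrE ?(ltW e0)//.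
  rewrite normrM ger0_norm ?exprn_ge0 ?addr_ge0 ?(ltW phi0)// => hh.
  rewrite ler_pdivlMr// mulrC; apply: le_trans hh; rewrite ler_wpM2r//.
  by rewrite lerXn2r// ?nnegrE ?addr_ge0 ?(ltW phi0)// lerDr.
have ephi' : eps / phi ^+ k <= phi by rewrite ler_pdivrMr// -exprS.
have cL i : `|c a i| <= 3 by have := psum_coord_le2 i ca2; lra.
have uL i : `|s * u i| <= 3.
  have := psum_coord_le2 i ca2; have := dl i; have := ler_normD (s * u i - c a i) (c a i).
  by rewrite subrK; lra.
have zero' : \sum_i (G b i)%:R * (s * u i) ^+ k.*2.+1 = 0.
  under eq_bigr do rewrite exprMn mulrCA.
  by rewrite -mulr_sumr zero mulr0.
move: Gb; rewrite inE -ltNge.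
have -> : \sum_i (G b i)%:R * x a i = \sum_i (G b i)%:R * (x a i - (s * u i) ^+ k.*2.+1).
  under [RHS]eq_bigr do rewrite mulrBr.
  by rewrite sumrB zero' subr0.
rewrite ltNge => /negP; apply; apply: le_trans (ler_norm_sum _ _ _) _.
have -> : l = n * (Q%:R * (C1 * eps)) by rewrite /l; ring.
rewrite /n mulr_natl -sumr_const; apply: ler_sum => i _.
rewrite normrM; apply: ler_pM => //; first by rewrite normr_nat ler_nat ltnW.
apply: le_trans (subX_le _ (cL i) (uL i)) _; rewrite distrC.
apply: le_trans (ler_wpM2l _ (dl i)) _; first by rewrite mulr_ge0// exprn_ge0.
by rewrite /C1 le_eqVlt; apply/orP; left; apply/eqP; ring.
Qed.

(** Round the coordinates and pick in each class of vectors with the same rounding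
    a representative in [P]: normalized, it is the centre of a cell. *)
Lemma covered_bounded (R : realType) (I : finType) k (phi eps : R) (P : (I -> R) -> Prop) :
  0 < phi <= 1 -> 0 < eps ->
  (forall u, P u -> (forall i, `|u i| <= 1) /\ 1 <= psum k u) ->
  exists2 X : R, 0 < X & covered k phi P X eps.
Proof.
move=> /andP[phi0 phi1] e0 Pbd.
pose d : R := eps / (#|I|.+1%:R * 3 ^+ k).
have t0 : 0 < (3 : R) ^+ k by rewrite exprn_gt0.
have d0 : 0 < d by rewrite divr_gt0// mulr_gt0.
pose M := Num.truncn (2 / d).
pose code (u : I -> R) : {ffun I -> 'I_M.+1} := [ffun i => inord (Num.truncn ((u i + 1) / d))].
have codeE u v : P u -> P v -> code u = code v -> forall i, `|u i - v i| <= d.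
  move=> Pu Pv /ffunP cuv i; have := cuv i; rewrite !ffunE => /(congr1 val).
  have bd w : P w -> (Num.truncn ((w i + 1) / d) <= M)%N /\ 0 <= (w i + 1) / d.
    move=> Pw; have [/(_ i) w1 _] := Pbd w Pw; move: w1; rewrite ler_norml => /andP[wa wb].
    split; last by apply: divr_ge0; [lra|exact: ltW].
    by apply: le_truncn; rewrite ler_pM2r ?invr_gt0//; lra.
  have [bu bu0] := bd u Pu; have [bv bv0] := bd v Pv.
  rewrite /= !inordK ?ltnS// => E.
  have hu1 := truncn_le ((u i + 1) / d); have hu2 := truncnS_gt ((u i + 1) / d).
  have hv1 := truncn_le ((v i + 1) / d); have hv2 := truncnS_gt ((v i + 1) / d).
  rewrite bu0 in hu1; rewrite bv0 in hv1; rewrite E in hu1 hu2.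
  rewrite -natr1 in hu2; rewrite -natr1 in hv2.
  have : `|(u i + 1) / d - (v i + 1) / d| <= 1 by rewrite ler_norml; apply/andP; split; lra.
  rewrite -mulrBl normrM normfV (gtr0_norm d0) ler_pdivrMr// mul1r.
  by rewrite opprD addrACA subrr addr0.
pose T : finType := {: {f : {ffun I -> 'I_M.+1} | `[< exists2 u, P u & code u = f >]}}.
have repT (a : T) : exists u, P u /\ code u = val a.
  by have /asboolP[u Pu ua] := valP a; exists u.
have [rep repP] := choice repT.
have rootT (a : T) : exists N : R, 0 < N /\ N ^+ k.*2.+2 = psum k (rep a).
  have [Pu _] := repP a; have [_ p1] := Pbd _ Pu.
  by have [N N0 NE] := exists_root k.*2.+1 (lt_le_trans ltr01 p1); exists N.
have [root rootP] := choice rootT.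
exists #|T|.+1%:R => //.
exists T, (fun a i => (root a)^-1 * rep a i); split.
- by rewrite ler_nat.
- move=> a; have [N0 NE] := rootP a; rewrite /unit_like psumZ exprVn -NE.
  by rewrite mulVf ?expf_neq0 ?gt_eqF//; apply/andP; split; lra.
move=> u Pu.
have ha : `[< exists2 v, P v & code v = code u >] by apply/asboolP; exists u.
pose a : T := exist _ (code u) ha; exists a.
have [N0 NE] := rootP a; have [Pv cv] := repP a.
set N := root a in N0 NE *; set v := rep a in NE Pv cv *.
have [v1 p1] := Pbd v Pv.
have N1 : 1 <= N by apply: (@expr_ge_base _ _ _ k.*2.+1); [exact: ltW| |rewrite NE].
have V0 : 0 <= N^-1 by rewrite invr_ge0 ltW.
have V1 : N^-1 <= 1 by rewrite invf_le1.
exists N^-1; first by rewrite invr_gt0.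
have duv := codeE _ _ Pu Pv (esym cv).
apply: le_trans (_ : \sum_(i : I) (3 ^+ k * d) ^+ 2 <= _).
  apply: ler_sum => i _; rewrite -mulrBr.
  have c3 : `|N^-1 * v i| + phi <= 3.
    rewrite normrM (ger0_norm V0); have := v1 i => h.
    have : N^-1 * `|v i| <= 1 * 1 by apply: ler_pM.
    lra.
  have c0 : 0 <= `|N^-1 * v i| + phi by rewrite addr_ge0// ltW.
  have key : `|(`|N^-1 * v i| + phi) ^+ k * (N^-1 * (u i - v i))| <= 3 ^+ k * d.
    rewrite normrM normrX (ger0_norm c0) (normrM N^-1 (u i - v i)) (ger0_norm V0).
    apply: ler_pM; [exact: exprn_ge0|exact: mulr_ge0|by rewrite lerXn2r ?nnegrE|].
    by apply: le_trans (duv i); rewrite ler_piMl.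
  by rewrite -[leLHS]real_normK ?num_real// lerXn2r ?nnegrE ?(le_trans _ key).
rewrite sumr_const -(mulr_natl (_ ^+ 2) #|I|).
have -> : eps ^+ 2 = #|I|.+1%:R ^+ 2 * (3 ^+ k * d) ^+ 2.
  have dE : #|I|.+1%:R * (3 ^+ k * d) = eps.
    by rewrite mulrA mulrC divfK// gt_eqF// mulr_gt0.
  by rewrite -exprMn dE.
apply: ler_wpM2r; first exact: sqr_ge0.
rewrite -natrX ler_nat expnS expn1 (leq_trans (leqnSn _))// leq_pmull//.
Qed.

Lemma expR_numeric (R : realType) : expR (6 / 5) * (5 / 18) <= 24 / 25 :> R.
Proof.
have e1 : expR (20^-1) <= 20 / 19 :> R.
  have := expR_ge1Dx (- 20^-1 : R); rewrite expRN => h.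
  have e0 := expR_gt0 (20^-1 : R).
  have := ler_wpM2r (ltW e0) h; rewrite mulVf ?gt_eqF//; lra.
have -> : 6 / 5 = 24%:R * 20^-1 :> R by lra.
rewrite expRM_natl; set x := expR _ in e1 *; have x0 : 0 <= x by exact: expR_ge0.
have step (a b c : R) n : 0 <= a -> a ^+ n <= b -> b * b <= c -> a ^+ (n + n) <= c.
  move=> a0 ab bc; apply: le_trans bc; rewrite exprD.
  by apply: ler_pM => //; exact: exprn_ge0.
have x3 : x ^+ 3 <= 7 / 6.
  apply: le_trans (_ : (20 / 19) ^+ 3 <= _); last by lra.
  by rewrite lerXn2r ?nnegrE//; lra.
have x6 : x ^+ 6 <= 49 / 36 by apply: (step _ _ _ 3 x0 x3); lra.
have x12 : x ^+ 12 <= 63 / 34 by apply: (step _ _ _ 6 x0 x6); lra.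
have x24 : x ^+ 24 <= 86 / 25 by apply: (step _ _ _ 12 x0 x12); lra.
lra.
Qed.

Lemma geometric_small (R : realType) (a r : R) : 0 <= r -> r <= 24 / 25 ->
  exists m : nat, a * r ^+ m < 1.
Proof.
move=> r0 r1; have grow (m : nat) : 1 + m%:R / 24 <= (25 / 24) ^+ m :> R.
  elim: m => [|m IH]; first by rewrite expr0; lra.
  rewrite exprS -natr1; have : 0 <= m%:R :> R by []; lra.
pose m := (Num.truncn (24 * a)).+1; exists m.
have ma : 24 * a < m%:R by rewrite truncnS_gt.
have p0 : 0 < (25 / 24 : R) ^+ m by rewrite exprn_gt0//; lra.
have [a0|a0] := leP a 0.
  by apply: le_lt_trans ltr01; rewrite mulr_le0_ge0 ?exprn_ge0.
apply: le_lt_trans (_ : a * (24 / 25) ^+ m < 1).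
  by rewrite ler_pM2l// lerXn2r ?nnegrE//; lra.
have -> : (24 / 25 : R) = (25 / 24)^-1 by rewrite invf_div.
rewrite exprVn ltr_pdivrMr// mul1r; apply: lt_le_trans (grow m); lra.
Qed.

(** A full step multiplies the radius of the cells by at most [5 / 18] and their
    number by [exp (6 / 5 * Kn)]. Since [exp (6 / 5) * (5 / 18) < 1], the number
    of cells times the [Kn]-th power of their radius tends to zero, and after
    sufficiently many steps [nonvanishing_map] applies. *)
Theorem odd_power_map (R : realType) (I J : finType) (B : J -> I -> R) (k k' Kn : nat) :
  (0 < #|I|)%N -> (0 < #|J|)%N -> (forall j i, `|B j i| = 1) ->
  #|I|%:R <= expR k.+1%:R :> R -> #|J|%:R <= expR k'.+1%:R :> R ->
  500 <= Kn%:R :> R ->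
  #|I|%:R <= expR (Kn%:R / 100) :> R -> #|J|%:R <= expR (Kn%:R / 100) :> R ->
  6 * expR 1 ^+ 2 * (k.*2.+1%:R * k'.*2.+1%:R) <= Kn%:R :> R ->
  exists (m : nat) (G : 'I_Kn -> I -> R), forall u : I -> R,
    (forall i, `|u i| <= 1) -> regular_state B k k' u -> 1 <= psum k u ->
    exists b, \sum_i G b i * iter m (full_step B k k') u i ^+ k.*2.+1 != 0.
Proof.
move=> I0 J0 B1 Ik Jk K5 IK JK dimK.
have K0 : 0 < Kn%:R :> R by lra.
have [phi finephi] := exists_fine_offset R I k.
have [phi' finephi'] := exists_fine_offset R J k'.
have [/andP[phi0 phi1] _] := finephi.
have e0 := expR_gt0 (1 : R).
pose q (k : nat) : R := 5 / 3 * (k.*2.+1%:R * expR 1) ^+ 2 / Kn%:R.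
have q0 l : 0 < q l.
  by rewrite /q divr_gt0// mulr_gt0// exprn_gt0// mulr_gt0.
have sq0 l : 0 < Num.sqrt (q l) by rewrite sqrtr_gt0.
have sqE l : 5 / 3 * (l.*2.+1%:R * expR 1) ^+ 2 <= Kn%:R * Num.sqrt (q l) ^+ 2.
  by rewrite sqr_sqrtr ?(ltW (q0 l))// /q [leRHS]mulrC divfK// gt_eqF.
have th : Num.sqrt (q k') * Num.sqrt (q k) <= 5 / 18.
  rewrite -sqrtrM ?(ltW (q0 _))// -[leRHS]ger0_norm; last by lra.
  rewrite -sqrtr_sqr ler_wsqrtr//.
  have -> : q k' * q k = (5 / 3 * (expR 1 ^+ 2 * (k.*2.+1%:R * k'.*2.+1%:R)) / Kn%:R) ^+ 2.
    by rewrite /q; field; rewrite gt_eqF.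
  have p0 : 0 <= expR 1 ^+ 2 * (k.*2.+1%:R * k'.*2.+1%:R) :> R.
    by rewrite mulr_ge0 ?sqr_ge0.
  have le1 : 5 / 3 * (expR 1 ^+ 2 * (k.*2.+1%:R * k'.*2.+1%:R)) / Kn%:R <= 5 / 18 :> R.
    by rewrite ler_pdivrMr//; lra.
  have a0 : 0 <= 5 / 3 * (expR 1 ^+ 2 * (k.*2.+1%:R * k'.*2.+1%:R)) / Kn%:R :> R.
    by apply: divr_ge0 => //; apply: mulr_ge0 => //; lra.
  by apply: lerXn2r le1; rewrite nnegrE//; lra.
have th1 : Num.sqrt (q k') * Num.sqrt (q k) <= 1 by apply: le_trans th _; lra.
have [eps0 eps00 iterP] := covered_iter I0 J0 B1 Ik Jk K5 IK JK finephi finephi'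
   (sq0 k) (sqE k) (sq0 k') (sqE k') th1.
have [C C0 lin] := nonvanishing_map I0 finephi.
pose eps := Num.min eps0 (phi ^+ k.+1).
have epsgt : 0 < eps by rewrite lt_min eps00 exprn_gt0.
pose P (u : I -> R) := [/\ forall i, `|u i| <= 1, regular_state B k k' u & 1 <= psum k u].
have [X X0 cov] := @covered_bounded R I k phi eps P (introT andP (conj phi0 phi1)) epsgt
  (fun u Pu => let: And3 a b c := Pu in conj a c).
set t := Num.sqrt (q k') * Num.sqrt (q k) in th iterP.
have t0 : 0 < t by rewrite mulr_gt0.
have rsmall : (expR (6 / 5) * t) ^+ Kn <= 24 / 25 :> R.
  have r1 : expR (6 / 5) * t <= 24 / 25 :> R.
    apply: le_trans (expR_numeric R); rewrite ler_pM2l ?expR_gt0//.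
  have K1 : (0 < Kn)%N by rewrite -(ltr0n R).
  rewrite -(prednK K1) exprS -[leRHS]mulr1; apply: ler_pM => //.
  - by rewrite mulr_ge0 ?expR_ge0 ?ltW.
  - by rewrite exprn_ge0// mulr_ge0 ?expR_ge0 ?ltW.
  - by rewrite exprn_ile1// ?mulr_ge0 ?expR_ge0 ?(ltW t0)//; lra.
have [|m small] := @geometric_small R (X * (C * eps) ^+ Kn) ((expR (6 / 5) * t) ^+ Kn) _ rsmall.
  by rewrite exprn_ge0// mulr_ge0 ?expR_ge0 ?ltW.
have [|u [] //|T [c [TX uc Pc]]] := iterP eps X P _ _ cov m.
  by rewrite epsgt ge_min lexx.
have tm0 : 0 < t ^+ m by rewrite exprn_gt0.
have tm1 : t ^+ m <= 1 by rewrite exprn_ile1 ?(ltW t0)//; lra.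
have rad : 0 < t ^+ m * eps <= phi ^+ k.+1.
  rewrite mulr_gt0//= (le_trans (_ : _ <= eps))//; first by rewrite ler_piMl// ltW.
  by rewrite ge_min lexx orbT.
have [|G HG] := lin Kn (t ^+ m * eps) rad T c uc.
  apply: le_lt_trans small.
  apply: le_trans (_ : X * expR (6 / 5 * Kn%:R) ^+ m * (C * (t ^+ m * eps)) ^+ Kn <= _).
    by rewrite ler_wpM2r// exprn_ge0// !mulr_ge0// ltW.
  rewrite le_eqVlt; apply/orP; left; apply/eqP.
  rewrite mulrC [6 / 5 * _]mulrC expRM_natl !exprMn -!exprM [(m * Kn)%N]mulnC.
  ring.
exists m, G => u u1 ru pu.
have [|a ca] := Pc (iter m (full_step B k k') u); first by exists u.
exact: HG ca.
Qed.

(** * The Sauer-Shelah lemma *)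

Definition shatters (T : finType) (S : {set {ffun T -> bool}}) (B : {set T}) : bool :=
  [forall p : {ffun T -> bool}, [exists f in S, [forall i in B, f i == p i]]].

Lemma shattersP (T : finType) (S : {set {ffun T -> bool}}) (B : {set T}) :
  reflect (forall p : {ffun T -> bool}, exists2 f, f \in S & forall i, i \in B -> f i = p i)
    (shatters S B).
Proof.
apply: (iffP forallP) => [h p|h p].
  have /existsP[f /andP[fS /forall_inP fp]] := h p.
  by exists f => // i iB; apply/eqP/fp.
have [f fS fp] := h p; apply/existsP; exists f; rewrite fS /=.
by apply/forall_inP => i iB; rewrite fp.
Qed.

(** Pajor's form of the Sauer-Shelah lemma.  Split the family according to the
    value at a coordinate [i]: a set shattered by both halves avoids [i], and
    adding [i] to it gives one more shattered set. *)
Lemma card_le_shattered (T : finType) (S : {set {ffun T -> bool}}) :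
  (#|S| <= #|[set B | shatters S B]%SET|)%N.
Proof.
move: {2}#|S|.+1 (ltnSn #|S|) => n; elim: n S => // n IH S Sn.
have [S1|/card_gt1P[f [g [fS gS fg]]]] := leqP #|S| 1.
  have [->|[f fS]] := finset.set_0Vmem S; first by rewrite cards0.
  apply: leq_trans S1 _; rewrite card_gt0; apply/finset.set0Pn; exists finset.set0.
  by rewrite inE; apply/shattersP => p; exists f => // i; rewrite inE.
have [i fgi] : exists i, f i != g i.
  apply/existsP; rewrite -negb_forall; apply: contra fg => /forallP h.
  by apply/eqP/ffunP => i; apply/eqP.
pose half b := [set h in S | h i == b]%SET.
have half_lt b : (#|half b| < n)%N.
  rewrite -ltnS; apply: leq_trans Sn; rewrite ltnS; apply: proper_card.
  apply/properP; split; first by apply/fintype.subsetP => h; rewrite inE => /andP[].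
  have [fb|fb] := eqVneq (f i) b; last by exists f; rewrite // inE fS.
  by exists g; rewrite // inE gS /=; rewrite -fb eq_sym.
have SE : #|S| = (#|half true| + #|half false|)%N.
  rewrite -(cardsID [set h : {ffun T -> bool} | h i] S); congr (_ + _)%N; apply: eq_card => h.
    by rewrite !inE; case: (h i); rewrite ?andbT ?andbF.
  by rewrite !inE; case: (h i); rewrite /= ?andbT ?andbF.
pose X b := [set B | shatters (half b) B]%SET.
have XS b B : B \in X b -> shatters S B.
  rewrite inE => /shattersP h; apply/shattersP => p; have [u + up] := h p.
  by rewrite inE => /andP[uS _]; exists u.
have Xi b B : B \in X b -> i \notin B.
  rewrite inE => /shattersP h; apply/negP => iB.
  have [u + up] := h [ffun=> ~~ b].
  by rewrite inE (up i iB) ffunE => /andP[_]; case: b {h up}.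
pose Y := [set (i |: B)%SET | B in (X true :&: X false)%SET]%SET.
have cardY : #|Y| = #|(X true :&: X false)%SET|.
  apply: card_in_imset => B B' /setIP[/Xi iB _] /setIP[/Xi iB' _] E.
  by rewrite -(setU1K iB) E setU1K.
rewrite SE; apply: leq_trans (leq_add (IH _ (half_lt true)) (IH _ (half_lt false))) _.
rewrite -/(X true) -/(X false) -cardsUI -cardY.
have disj : [disjoint (X true :|: X false)%SET & Y].
  rewrite disjoint_subset; apply/fintype.subsetP => B BX; rewrite !inE.
  apply/imsetP => -[B' _ E]; move: BX; rewrite inE => /orP[] /Xi;
    by rewrite E setU11.
move: disj; rewrite -leq_card_setU => /eqP <-; apply: subset_leq_card.
apply/fintype.subsetP => B /setUP[].
  by move=> /setUP[] /XS ?; rewrite inE.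
case/imsetP => B' /setIP[]; rewrite !inE => /shattersP h1 /shattersP h0 ->.
apply/shattersP => p.
have hp : exists2 u, u \in half (p i) & forall j, j \in B' -> u j = p j.
  by case: (p i); [exact: h1|exact: h0].
have [u + up] := hp; rewrite inE => /andP[uS /eqP ui]; exists u => // j.
by rewrite !inE => /orP[/eqP ->|/up].
Qed.

(** Give a set [B] the weight [x ^+ #|B|] with [x = d / #|T|]. A shattered set has
    weight at least [x ^+ d], and all sets together weigh
    [(1 + x) ^+ #|T| <= exp d]. *)
Lemma card_shattered_le (R : realType) (T : finType) (S : {set {ffun T -> bool}})
    (d : nat) :
  (0 < d <= #|T|)%N -> (forall B, shatters S B -> (#|B| <= d)%N) ->
  #|S|%:R <= (expR 1 * #|T|%:R / d%:R) ^+ d :> R.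
Proof.
move=> /andP[d0 dN] Sd.
have d0' : 0 < d%:R :> R by rewrite ltr0n.
have N0 : 0 < #|T|%:R :> R by rewrite ltr0n (leq_trans d0).
pose x : R := d%:R / #|T|%:R.
have x0 : 0 < x by rewrite divr_gt0.
have x1 : x <= 1 by rewrite ler_pdivrMr// mul1r ler_nat.
have total : \sum_(B : {set T}) x ^+ #|B| = (1 + x) ^+ #|T|.
  rewrite addrC -prodr_const (bigA_distr 1 +%R (fun=> x) (fun=> 1)).
  apply: eq_bigr => B _; rewrite -big_mkcond /= -prodr_const.
  by [].
have low : #|S|%:R * x ^+ d <= (1 + x) ^+ #|T|.
  apply: le_trans (_ : \sum_(B in [set B | shatters S B]%SET) x ^+ d <= _).
    rewrite sumr_const -(mulr_natl (x ^+ d)) ler_wpM2r ?exprn_ge0 ?(ltW x0)//.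
    by rewrite ler_nat card_le_shattered.
  rewrite -total [leRHS](bigID (mem [set B | shatters S B]%SET))/=.
  rewrite -[leLHS]addr0; apply: lerD.
    by apply: ler_sum => B; rewrite inE => /Sd Bd; rewrite ler_wiXn2l// ltW.
  by apply: sumr_ge0 => B _; rewrite exprn_ge0// ltW.
have up : (1 + x) ^+ #|T| <= expR 1 ^+ d.
  rewrite -expRM_natl mulr1.
  have -> : d%:R = #|T|%:R * x by rewrite /x mulrCA mulfV ?gt_eqF// mulr1.
  rewrite expRM_natl; apply: lerXn2r; rewrite ?nnegrE ?expR_ge0 ?expR_ge1Dx//.
  by rewrite addr_ge0// ltW.
rewrite -mulrA -invf_div -/x exprMn exprVn ler_pdivlMr ?exprn_gt0//.
exact: le_trans low up.
Qed.

(** * Numerical bounds *)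

(** Repeated squaring of [1 - y <= exp (- y)] for [y = 17 / 800], with the
    intermediate values rounded down to short fractions. *)
Lemma ln2_ge (R : realType) : 17 / 25 <= ln 2 :> R.
Proof.
rewrite -[leLHS]expRK ler_ln ?posrE ?expR_gt0//.
suff : 2^-1 <= expR (- (17 / 25)) :> R.
  by rewrite expRN lef_pV2 ?posrE ?expR_gt0.
have -> : - (17 / 25) = 2%:R * (2%:R * (2%:R * (2%:R * (2%:R * (- (17 / 800)))))) :> R by field.
have step (x y z : R) : 0 <= x -> x <= expR z -> y <= x ^+ 2 -> y <= expR (2%:R * z).
  move=> x0 xz yx; rewrite expRM_natl; apply: le_trans yx _.
  by apply: lerXn2r xz; rewrite nnegrE ?expR_ge0.
apply: (@step (7086 / 10000)); [lra| |lra].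
apply: (@step (8418 / 10000)); [lra| |lra].
apply: (@step (9175 / 10000)); [lra| |lra].
apply: (@step (9579 / 10000)); [lra| |lra].
apply: (@step (783 / 800)); [lra| |lra].
have := expR_ge1Dx (- (17 / 800) : R); lra.
Qed.

Lemma expR1_ge (R : realType) : 64 / 25 <= expR 1 :> R.
Proof.
have -> : 1 = 2%:R * (2%:R * (2%:R * (1 / 8))) :> R by field.
have step (x y z : R) : 0 <= x -> x <= expR z -> y <= x ^+ 2 -> y <= expR (2%:R * z).
  move=> x0 xz yx; rewrite expRM_natl; apply: le_trans yx _.
  by apply: lerXn2r xz; rewrite nnegrE ?expR_ge0.
apply: (@step (8 / 5)); [lra| |lra].
apply: (@step (253 / 200)); [lra| |lra].
apply: (@step (9 / 8)); [lra| |lra].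
have := expR_ge1Dx (1 / 8 : R); lra.
Qed.

Section Numerics.
Variables (R : realType) (N d : nat).
Hypotheses (N2 : (2 <= N)%N) (dN : (0 < d <= N)%N).

Let bound : R := C0 R * d%:R * ln (2 * expR 1 * N%:R / d%:R) * ln (2 * N%:R).

Let N0 : 0 < N%:R :> R. Proof. by rewrite ltr0n (leq_trans _ N2). Qed.
Let d0 : 0 < d%:R :> R. Proof. by rewrite ltr0n; case/andP: dN. Qed.

Let lnA : ln (2 * expR 1 * N%:R / d%:R) = ln 2 + 1 + ln (N%:R / d%:R) :> R.
Proof.
have e0 := expR_gt0 (1 : R).
have h : 0 < 2 * expR 1 :> R by lra.
by rewrite -mulrA lnM ?posrE ?h ?divr_gt0// lnM ?posrE// expRK.
Qed.

Let lnB : ln (2 * N%:R) = ln 2 + ln N%:R :> R.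
Proof. by rewrite lnM ?posrE. Qed.

Let lnND : 0 <= ln (N%:R / d%:R) :> R.
Proof. by apply: ln_ge0; rewrite ler_pdivlMr// mul1r ler_nat; case/andP: dN. Qed.

Let lnNDN : ln (N%:R / d%:R) <= ln N%:R :> R.
Proof.
rewrite ler_ln ?posrE ?divr_gt0// ler_pdivrMr// ler_peMr ?(ltW N0)// ler1n.
by case/andP: dN.
Qed.

Let lnN : ln 2 <= ln N%:R :> R.
Proof. by rewrite ler_ln ?posrE// ler_nat. Qed.

Let a : R := d%:R * ln (2 * expR 1 * N%:R / d%:R).
Let b : R := ln (2 * N%:R).

Let aE : a = d%:R * ln 2 + (d%:R * (1 + ln (N%:R / d%:R))).
Proof. by rewrite /a lnA; ring. Qed.

Let a_ge : 59 / 25 <= a.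
Proof.
have L := ln2_ge R; have LN := lnN; have LD := lnND; rewrite /a lnA.
have [d1|d2] := leqP d 1.
  have {d1} -> : d = 1%N by apply/eqP; rewrite eqn_leq d1; case/andP: dN.
  by rewrite mul1r divr1; lra.
have {}d2 : 2 <= d%:R :> R by rewrite ler_nat.
have h : 42 / 25 <= ln 2 + 1 + ln (N%:R / d%:R) :> R by lra.
apply: le_trans (_ : 2 * (42 / 25) <= _); first lra.
by apply: ler_pM => //; lra.
Qed.

Let b_ge : 34 / 25 <= b.
Proof. by have L := ln2_ge R; have LN := lnN; rewrite /b lnB; lra. Qed.

Let boundE : bound = 24 * expR 1 ^+ 2 * (a * b).
Proof. by rewrite /bound /C0 /a /b; ring. Qed.

Let e2 : 655 / 100 <= expR 1 ^+ 2 :> R.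
Proof.
apply: le_trans (_ : (64 / 25) ^+ 2 <= _); first lra.
by apply: lerXn2r (expR1_ge R); rewrite nnegrE ?expR_ge0//; lra.
Qed.

Lemma bound_ge0 : 0 <= bound.
Proof.
rewrite boundE; apply: mulr_ge0; first by have := e2; lra.
by apply: mulr_ge0; [have := a_ge|have := b_ge]; lra.
Qed.

Lemma bound_le : bound <= 192 * expR 1 ^+ 2 * (d%:R * ln N%:R ^+ 2).
Proof.
have L := ln2_ge R.
have -> : 192 * expR 1 ^+ 2 * (d%:R * ln N%:R ^+ 2) =
  24 * expR 1 ^+ 2 * (d%:R * (4 * ln N%:R) * (2 * ln N%:R)) :> R by ring.
rewrite boundE; apply: ler_wpM2l; first by have := e2; lra.
apply: ler_pM; [by have := a_ge; lra|by have := b_ge; lra| |].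
  by rewrite /a ler_pM2l// lnA; have := lnNDN; have := lnN; lra.
by rewrite /b lnB; have := lnN; lra.
Qed.

(** With [a = d * ln (2 e N / d)] and [b = ln (2 N)], the integral parts [k] and
    [k'] satisfy [2k + 1 <= 2 a] and [2k' + 1 <= 2 b] (the factors 2 in the
    logarithms pay for the summands 1), and [24 = 6 * 2 * 2]. The dimension is at
    least 500 because the smallest case, [d = 1] and [N = 2], gives more than 504
    with the estimates [e >= 64 / 25] and [ln 2 >= 17 / 25]. *)
Lemma bound_params (m : R) : 1 <= m -> m <= (expR 1 * N%:R / d%:R) ^+ d ->
  let Kn := (Num.truncn bound).+1 in
  let k := Num.truncn (ln m) in let k' := Num.truncn (ln N%:R : R) in
  [/\ m <= expR k.+1%:R, N%:R <= expR k'.+1%:R :> R & 500 <= Kn%:R :> R] /\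
  [/\ m <= expR (Kn%:R / 100), N%:R <= expR (Kn%:R / 100) :> R &
      6 * expR 1 ^+ 2 * (k.*2.+1%:R * k'.*2.+1%:R) <= Kn%:R :> R].
Proof.
move=> m1 md Kn k k'.
have L := ln2_ge R; have LN := lnN; have A := a_ge; have B := b_ge; have E := e2.
have m0 : 0 < m by lra.
have lnm0 : 0 <= ln m by exact: ln_ge0.
have d1 : 1 <= d%:R :> R by rewrite ler1n; case/andP: dN.
have dL : 17 / 25 <= d%:R * ln 2 :> R.
  by rewrite -[leLHS]mul1r; apply: ler_pM => //; lra.
have lnm : ln m <= a - d%:R * ln 2.
  have eN0 : 0 < expR 1 * N%:R / d%:R :> R by rewrite divr_gt0// mulr_gt0 ?expR_gt0.
  rewrite aE addrAC subrr add0r; move: md; rewrite -ler_ln ?posrE ?exprn_gt0//.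
  by rewrite lnXn// -mulrA lnM ?posrE ?expR_gt0 ?divr_gt0// expRK -(mulr_natl (1 + _)).
have boundK : bound < Kn%:R by exact: truncnS_gt.
have K1 : 24 * (655 / 100) * (a * b) <= Kn%:R.
  apply: le_trans (ltW boundK); rewrite boundE ler_wpM2r//; last lra.
  by apply: mulr_ge0; lra.
have ab : 59 / 25 * (34 / 25) <= a * b by apply: ler_pM => //; lra.
have aK : a <= Kn%:R / 100.
  have : a * (34 / 25) <= a * b by apply: ler_wpM2l => //; lra.
  lra.
have bK : b <= Kn%:R / 100.
  have : 59 / 25 * b <= a * b by apply: ler_wpM2r => //; lra.
  lra.
have trunc_le (x : R) : 0 <= x -> (Num.truncn x).*2.+1%:R <= 2 * x + 1 :> R.
  move=> x0; have : (Num.truncn x)%:R <= x by rewrite truncn_le.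
  by rewrite -natr1 -addnn natrD; lra.
split; split.
- by rewrite -{1}(@lnK _ m) ?posrE// ler_expR ltW// truncnS_gt.
- by rewrite -{1}(@lnK _ N%:R) ?posrE// ler_expR ltW// truncnS_gt.
- lra.
- by rewrite -{1}(@lnK _ m) ?posrE// ler_expR; lra.
- rewrite -{1}(@lnK _ N%:R) ?posrE// ler_expR.
  by apply: le_trans bK; rewrite /b lnB; lra.
apply: le_trans (ltW boundK); rewrite boundE.
have -> : 24 * expR 1 ^+ 2 * (a * b) = 6 * expR 1 ^+ 2 * ((2 * a) * (2 * b)) :> R by ring.
apply: ler_wpM2l; first lra.
apply: ler_pM => //.
  by apply: le_trans (trunc_le _ lnm0) _; lra.
have lnN0 : 0 <= ln N%:R :> R by lra.
by apply: le_trans (trunc_le _ lnN0) _; rewrite /b lnB; lra.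
Qed.

End Numerics.

(** * Odd maps and the index *)

(** The value [psum k u] is the pairing of [xi] with the first half step, and [xi]
    has mass at most 1, so that the norm of the half step is at least as large. *)
Lemma good_initial (R : realType) (I J : finType) (B : J -> I -> R) (k k' : nat)
    (xi : J -> R) (u : I -> R) :
  (forall i, u i = \sum_j B j i * xi j) ->
  \sum_j `|xi j| <= 1 -> 1 <= psum k u -> good_state B k k' u.
Proof.
set s := psum k u; set y := pstep B k u => uE xi1 s1.
have sE : s = \sum_j xi j * y j.
  rewrite /s /psum /y /pstep; under [RHS]eq_bigr do rewrite mulr_sumr.
  rewrite exchange_big/=; apply: eq_bigr => i _; rewrite exprS {1}uE mulr_suml.
  by apply: eq_bigr => j _; ring.
have y0 : 0 < psum k' y.
  rewrite lt_def psum_ge0 andbT; apply/eqP => Sy0.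
  suff : s = 0 by lra.
  rewrite sE; apply: big1 => j _.
  have := psum_coord k' y j; rewrite Sy0 => h.
  have : y j ^+ k'.*2.+2 == 0 by rewrite eq_le h evenX_ge0.
  by rewrite expf_eq0 => /andP[_ /eqP ->]; rewrite mulr0.
have [t t0 tE] := exists_root k'.*2.+1 y0.
have yt j : `|y j| <= t.
  have := psum_coord k' y j; rewrite -tE -evenX_norm.
  by rewrite ler_pXn2r// nnegrE ltW.
have st : s <= t.
  apply: le_trans (_ : \sum_j `|xi j| * t <= _).
    rewrite sE; apply: ler_sum => j _; apply: le_trans (ler_norm _) _.
    by rewrite normrM ler_wpM2l.
  by rewrite -mulr_suml ler_piMl// ltW.
rewrite /good_state -/s -/y -tE -exprM.
have s0 : 0 <= s by lra.
apply: le_trans (_ : s ^+ (k'.*2.+2 * k.+1) <= _).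
  by rewrite ler_weXn2l// mulnC -doubleS -doubleMl doubleMr leq_mul2l doubleS leqnSn orbT.
by apply: lerXn2r st; rewrite nnegrE //; apply: ltW.
Qed.

Lemma pstepN (R : realType) (I J : finType) (B : J -> I -> R) k (u u' : I -> R) :
  (forall i, u' i = - u i) -> forall j, pstep B k u' j = - pstep B k u j.
Proof.
move=> uu j; rewrite /pstep -sumrN; apply: eq_bigr => i _.
by rewrite uu exprNn -signr_odd /= odd_double expr1 mulN1r mulrN.
Qed.

Lemma full_stepN (R : realType) (I J : finType) (B : J -> I -> R) k k' m (u u' : I -> R) :
  (forall i, u' i = - u i) -> forall i,
  iter m (full_step B k k') u' i = - iter m (full_step B k k') u i.
Proof. by move=> uu; elim: m => // m IH; do 2!apply: pstepN. Qed.

Section Continuity.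
Variables (R : realType) (T : topologicalType).

Lemma continuous_diff (f g : T -> R) :
  continuous f -> continuous g -> continuous (fun x => f x - g x).
Proof. by move=> cf cg x; apply: cvgB; [exact: cf|exact: cg]. Qed.

Lemma continuous_expr (f : T -> R) n : continuous f -> continuous (fun x => f x ^+ n).
Proof.
move=> cf x; apply: (@continuous_comp _ _ _ f (fun y => y ^+ n)); first exact: cf.
exact: exprn_continuous.
Qed.

Lemma continuous_linear_comb (I : finType) (c : I -> R) (f : I -> T -> R) :
  (forall i, continuous (f i)) -> continuous (fun x => \sum_i c i * f i x).
Proof.
move=> cf x; rewrite /index_enum; elim: (Finite.enum I) => [|i s IH].
  under eq_fun do rewrite big_nil; exact: cst_continuous.
under eq_fun do rewrite big_cons; apply: cvgD => //.
by apply: cvgM; [exact: cvg_cst|exact: cf].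
Qed.

Lemma continuous_pstep (I J : finType) (B : J -> I -> R) k (u : T -> I -> R) :
  (forall i, continuous (u^~ i)) -> forall j, continuous (fun x => pstep B k (u x) j).
Proof.
by move=> cu j; apply: continuous_linear_comb => i; exact: continuous_expr.
Qed.

Lemma continuous_full_step (I J : finType) (B : J -> I -> R) k k' m (u : T -> I -> R) :
  (forall i, continuous (u^~ i)) ->
  forall i, continuous (fun x => iter m (full_step B k k') (u x) i).
Proof.
move=> cu; elim: m => // m IH; rewrite /= /full_step.
by do 2!apply: continuous_pstep.
Qed.

Lemma continuous_row n (f : 'I_n -> T -> R) x :
  (forall i, {for x, continuous (f i)}) -> {for x, continuous (fun y => \row_i f i y)}.
Proof.
move=> cf A [P xP PA].
have nb i : nbhs x [set y | P ord0 i (f i y)]%classic.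
  by apply: cf; have := xP ord0 i; rewrite mxE.
have := @filter_forall _ _ _ _ (nbhs_filter x) nb.
apply: (@filterS _ _ (nbhs_filter x)) => y yP; apply: PA => j i.
by rewrite (ord1 j) mxE; exact: yP.
Qed.

End Continuity.

(** Divide by the Euclidean norm, which is continuous and positive on [X]. *)
Lemma has_equivariant_map_of_odd (R : realType) (T : topologicalType) (X : set T)
    (nu : T -> T) (k : nat) (F : 'I_k.+1 -> T -> R) :
  (forall b, continuous (F b)) ->
  (forall x, X x -> exists b, F b x != 0) ->
  (forall b x, F b (nu x) = - F b x) ->
  has_equivariant_map R X nu k.
Proof.
move=> cF F0 odd; pose S x := \sum_b F b x ^+ 2.
have S0 x : X x -> 0 < S x.
  move=> /F0[b b0]; rewrite /S (bigD1 b)//=; apply: ltr_pwDl.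
    by rewrite lt_def sqr_ge0 andbT expf_eq0.
  by apply: sumr_ge0 => b' _; exact: sqr_ge0.
have cS : continuous S.
  rewrite /S; under eq_fun do under eq_bigr do rewrite -[_ ^+ 2]mul1r.
  by apply: continuous_linear_comb => b; exact: continuous_expr.
exists (fun x => \row_b (F b x / Num.sqrt (S x))); split.
- apply: continuous_in_subspaceT => x /set_mem Xx; apply: continuous_row => b.
  apply: cvgM; first exact: cF.
  apply: cvgV; first by rewrite gt_eqF// sqrtr_gt0 S0.
  by apply: (@continuous_comp _ _ _ S Num.sqrt); [exact: cS|exact: sqrt_continuous].
- move=> x Xx; rewrite /sphere /=.
  under eq_bigr do rewrite mxE expr_div_n sqr_sqrtr ?(ltW (S0 x Xx))//.
  by rewrite -mulr_suml mulfV// gt_eqF// S0.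
- move=> x Xx; apply/rowP => b; rewrite !mxE odd mulNr.
  by rewrite /S; under eq_bigr do rewrite odd sqrrN.
Qed.

Lemma ind_le (R : realType) (T : topologicalType) (X : set T) (nu : T -> T) (k : nat) (c : R) :
  has_equivariant_map R X nu k -> k%:R <= c -> (ind R X nu <= c%:E)%E.
Proof.
move=> hk kc; rewrite /ind; case: asboolP => _.
  by rewrite lee_fin; apply: le_trans kc; apply: le_trans (ler0n R k); rewrite lerN10.
case: pselect => [exk|[]]; last by exists k; apply/asboolP.
rewrite lee_fin; case: ex_minnP => l _ /(_ k) lk.
by apply: le_trans kc; rewrite ler_nat lk//; apply/asboolP.
Qed.

(** * The index of the sign complex *)

Definition row_patterns (M N : nat) (A : 'M[int]_(M, N)) : {set {ffun 'I_N -> bool}} :=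
  [set [ffun i => A r i == -1] | r : 'I_M]%SET.

Lemma total_signE (M N : nat) (A : 'M[int]_(M, N)) r i :
  total_sign A -> A r i = (-1) ^+ (A r i == -1).
Proof. by move=> tA; case: (tA r i) => ->. Qed.

Lemma shattered_row_patterns (M N : nat) (A : 'M[int]_(M, N)) (B : {set 'I_N}) :
  total_sign A -> shatters (row_patterns A) B -> shattered A B.
Proof.
move=> tA /shattersP h; apply/forallP => p.
have [f /imsetP[r _ ->] fp] := h p; apply/existsP; exists r.
by apply/forall_inP => i iB; rewrite (total_signE r i tA) -fp// ffunE.
Qed.

Lemma VCdim_le (M N : nat) (A : 'M[int]_(M, N)) : (VCdim A <= N)%N.
Proof.
by apply/bigmax_leqP => B _; rewrite -[leqRHS](card_ord N) max_card.
Qed.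

Lemma row_patterns_gt0 (M N : nat) (A : 'M[int]_(M, N)) :
  (0 < VCdim A)%N -> (0 < #|row_patterns A|)%N.
Proof.
move=> d0; rewrite card_gt0; apply: contraTneq d0 => P0; rewrite -eqn0Ngt.
rewrite -leqn0; apply/bigmax_leqP => B /forallP/(_ [ffun=> true])/existsP[r _].
have : [ffun i => A r i == -1] \in row_patterns A by apply/imsetP; exists r.
by rewrite P0 inE.
Qed.

Lemma card_row_patterns_le (R : realType) (M N : nat) (A : 'M[int]_(M, N)) :
  total_sign A -> (0 < VCdim A)%N ->
  #|row_patterns A|%:R <= (expR 1 * N%:R / (VCdim A)%:R) ^+ VCdim A :> R.
Proof.
move=> tA d0; have := @card_shattered_le R _ (row_patterns A) (VCdim A).
rewrite card_ord; apply; first by rewrite d0 VCdim_le.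
by move=> B /(shattered_row_patterns tA) BA; apply: leq_bigmax_cond.
Qed.

Section SignRealization.
Variables (R : realType) (M N : nat) (A : 'M[int]_(M, N)).
Hypothesis tA : total_sign A.

Let point := 'rV[R]_#|{: 'I_N * bool}|.

(** The signed columns are the vertices of a cross-polytope; these are the
    coordinates of the point in it. *)
Definition signed_coord (x : point) (j : 'I_N) : R :=
  barycentric x (j, true) - barycentric x (j, false).

Definition row_value (r : {ffun 'I_N -> bool}) (x : point) : R :=
  \sum_j (-1) ^+ r j * signed_coord x j.

Lemma signed_coord_involution (x : point) j :
  signed_coord (sign_involution R N x) j = - signed_coord x j.
Proof. by rewrite /signed_coord /sign_involution !barycentric_induced /flip_sign/= opprB. Qed.

Lemma row_value_involution r (x : point) :
  row_value r (sign_involution R N x) = - row_value r x.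
Proof.
by rewrite /row_value -sumrN; apply: eq_bigr => j _; rewrite signed_coord_involution mulrN.
Qed.

Lemma continuous_row_value r : continuous (row_value r).
Proof.
apply: continuous_linear_comb => j.
by apply: continuous_diff; exact: (@coord_continuous R 1 _ ord0 (enum_rank _)).
Qed.

Lemma sum_barycentric_pair (x : point) : sign_realization A x ->
  \sum_j (barycentric x (j, true) + barycentric x (j, false)) = 1.
Proof.
move=> [_ <- _]; transitivity (\sum_(j : 'I_N) \sum_(b : bool) barycentric x (j, b)).
  by apply: eq_bigr => j _; rewrite big_bool.
by rewrite pair_bigA; apply: eq_bigr => -[].
Qed.

Lemma signed_coord_mass (x : point) : sign_realization A x ->
  \sum_j `|signed_coord x j| <= 1.
Proof.
move=> Kx; rewrite -(sum_barycentric_pair Kx); have [x0 _ _] := Kx.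
apply: ler_sum => j _; have := x0 (j, true); have := x0 (j, false) => h h'.
by apply: le_trans (ler_normB _ _) _; rewrite !ger0_norm.
Qed.

(** On the simplex of a row [r] each coordinate [signed_coord x j] has the sign of
    the entry of [r], so that nothing cancels; on the opposite simplex all signs
    are reversed. *)
Lemma row_value_extreme (x : point) : sign_realization A x ->
  exists2 r, r \in row_patterns A & `|row_value r x| = 1.
Proof.
move=> Kx; have [x0 _] := Kx; rewrite inE => /existsP[f /andP[Ff /fintype.subsetP sf]].
have {}sf v : v \notin f -> barycentric x v = 0.
  by apply: contraNeq => h; apply: sf; rewrite inE.
have [r [e fE]] : exists r (e : bool), forall j b,
    A r j != (-1) ^+ e * (if b then 1 else -1) -> (j, b) \notin f.
  move: Ff; rewrite inE => /orP[] /imsetP[r _ ->]; exists r.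
    by exists false => j b; rewrite inE mul1r.
  exists true => j b; apply: contra => /imsetP[[j' b']]; rewrite inE /= => /eqP Ar [-> ->].
  by rewrite Ar; case: b' {Ar}.
exists [ffun i => A r i == -1]; first by apply/imsetP; exists r.
suff -> : row_value [ffun i => A r i == -1] x = (-1) ^+ e.
  by rewrite normrX normrN1 expr1n.
rewrite -[RHS]mulr1 -[X in _ = _ * X](sum_barycentric_pair Kx) mulr_sumr.
apply: eq_bigr => j _; rewrite /signed_coord ffunE.
have ht := fE j true; have hf := fE j false.
case: (tA r j) ht hf => -> ; case: e {fE} => /= ht hf.
- by rewrite (sf _ (ht isT)) !expr0 expr1; ring.
- by rewrite (sf _ (hf isT)) !expr0; ring.
- by rewrite (sf _ (hf isT)) !expr1; ring.
- by rewrite (sf _ (ht isT)) expr0 expr1; ring.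
Qed.

End SignRealization.

Theorem corollary13 (R : realType) :
  exists2 K : R, 0 < K &
    forall (M N d : nat) (A : 'M[int]_(M, N)),
      total_sign A -> (2 <= N)%N -> VCdim A = d -> (1 <= d)%N ->
      let bound :=
        C0 R * d%:R * ln (2 * expR 1 * N%:R / d%:R) * ln (2 * N%:R) in
      (ind R (sign_realization A) (sign_involution R N) <= bound%:E)%E /\
      `|bound| <= K * (d%:R * ln N%:R ^+ 2).
Proof.
exists (192 * expR 1 ^+ 2); first by rewrite mulr_gt0// exprn_gt0// expR_gt0.
move=> M N d A tA N2 dE d1 bound.
have dN : (0 < d <= N)%N by rewrite d1 -dE VCdim_le.
have bound0 : 0 <= bound by exact: bound_ge0.
split; last by rewrite ger0_norm//; exact: bound_le.
apply: (@ind_le _ _ _ _ (Num.truncn bound)); last by rewrite truncn_le.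
pose I := {r : {ffun 'I_N -> bool} | r \in row_patterns A}.
have cardI : #|{: I}| = #|row_patterns A| by rewrite card_sig.
have I0 : (0 < #|{: I}|)%N by rewrite cardI row_patterns_gt0// dE.
have J0 : (0 < #|'I_N|)%N by rewrite card_ord (leq_trans _ N2).
pose B (j : 'I_N) (i : I) : R := (-1) ^+ val i j.
have B1 j i : `|B j i| = 1 by rewrite /B normrX normrN1 expr1n.
have m1 : 1 <= #|{: I}|%:R :> R by rewrite ler1n.
have mle : #|{: I}|%:R <= (expR 1 * N%:R / d%:R) ^+ d :> R.
  by rewrite cardI -dE card_row_patterns_le// dE.
have [[mk Nk K5] [mK NK eK]] := bound_params N2 dN m1 mle.
set k := Num.truncn (ln #|{: I}|%:R) in mk eK; set k' := Num.truncn (ln N%:R) in Nk eK.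
have {}Nk : #|'I_N|%:R <= expR k'.+1%:R :> R by rewrite card_ord.
have {}NK : #|'I_N|%:R <= expR ((Num.truncn bound).+1%:R / 100) :> R by rewrite card_ord.
have [m [G HG]] := odd_power_map I0 J0 B1 mk Nk K5 mK NK eK.
pose u (x : 'rV[R]_#|{: 'I_N * bool}|) (i : I) : R := row_value (val i) x.
apply: (@has_equivariant_map_of_odd _ _ _ _ _ (fun b x =>
  \sum_i G b i * iter m (full_step B k k') (u x) i ^+ k.*2.+1)).
- have cu i : continuous (u^~ i) by exact: continuous_row_value.
  by move=> b; apply: (continuous_pstep (B := G)) => i; exact: continuous_full_step.
- move=> x Kx; apply: HG.
  + move=> i; apply: le_trans (signed_coord_mass Kx).
    apply: le_trans (ler_norm_sum _ _ _) _.
    by apply: ler_sum => j _; rewrite normrM normrX normrN1 expr1n mul1r.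
  + have [r rA r1] := row_value_extreme tA Kx.
    have S1 : 1 <= psum k (u x).
      apply: le_trans (psum_coord k (u x) (Sub r rA)).
      by rewrite -evenX_norm /u /= r1 expr1n.
    split; last exact: lt_le_trans S1.
    by apply: (@good_initial _ _ _ _ _ _ (signed_coord x)) => //; exact: signed_coord_mass Kx.
  + have [r rA r1] := row_value_extreme tA Kx.
    apply: le_trans (psum_coord k (u x) (Sub r rA)).
    by rewrite -evenX_norm /u /= r1 expr1n.
- move=> b x; rewrite -sumrN; apply: eq_bigr => i _.
  rewrite (@full_stepN _ _ _ _ _ _ _ (u x)); last by move=> i'; exact: row_value_involution.
  by rewrite exprNn -signr_odd /= odd_double expr1 mulN1r mulrN.
Qed.
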